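(* If $\{\mathcal{S}_n\}_{n=1}^\infty$ is an inductive system of $(\min,\max)$-nuclear operator systems, then $\varinjlim\mathcal{S}_n$ is also $(\min,\max)$-nuclear.
   Context: An operator system is a unital self-adjoint subspace of $B(H)$. Inductive systems of operator systems have unital complete order embeddings $u_n:\mathcal{S}_n\to\mathcal{S}_{n+1}$ as connecting maps; the inductive limit $\varinjlim\mathcal{S}_n$ is the operator system $\mathcal{S}$ with unital complete order embeddings $\lambda_n:\mathcal{S}_n\to\mathcal{S}$ satisfying $\lambda_n=\lambda_{n+1}\circ u_n$ and $\mathcal{S}=\overline{\bigcup_n\lambda_n(\mathcal{S}_n)}$, universal for compatible families of unital completely positive maps. For operator systems $\mathcal{S},\mathcal{T}$, the tensor products are operator system structures on the algebraic tensor product. $\min$: $u\in M_n(\mathcal{S}\otimes_{\min}\mathcal{T})^+$ iff $(\varphi\otimes\psi)^{(n)}(u)\ge 0$ for all unital completely positive maps $\varphi:\mathcal{S}\to M_k$, $\psi:\mathcal{T}\to M_m$, $k,m\in\mathbb{N}$. $\max$: the positive cones are the Archimedeanizations $\{u\in M_n(\mathcal{S}\otimes\mathcal{T}): u+\varepsilon 1\in D_n\ \forall\varepsilon>0\}$ of $D_n=\{\alpha(P\otimes Q)\alpha^*:P\in M_k(\mathcal{S})^+,Q\in M_m(\mathcal{T})^+,\alpha\in M_{n,km}(\mathbb{C}),k,m\in\mathbb{N}\}$. For operator system tensor products $\alpha,\beta$, $\mathcal{S}$ is $(\alpha,\beta)$-nuclear if the identity map $\mathcal{S}\otimes_\alpha\mathcal{T}\to\mathcal{S}\otimes_\beta\mathcal{T}$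 is a complete order isomorphism for every operator system $\mathcal{T}$. *)

(* Defs.v *)
From HB Require Import structures.
From mathcomp Require Import all_boot all_order all_algebra.
From mathcomp Require Import all_classical all_reals.
From mathcomp Require Import topology normedtype.
From mathcomp Require Import complex mxtens.

Set Implicit Arguments.
Unset Strict Implicit.
Unset Printing Implicit Defensive.

Import Order.TTheory GRing.Theory Num.Theory.
Import numFieldNormedType.Exports.

Local Open Scope classical_set_scope.
Local Open Scope ring_scope.
Local Open Scope quotient_scope.

(** The algebraic tensor product [tens U V]: formal sums of pairs modulo the
    congruence generated by bilinearity. *)

Section TensorProduct.
Context {K : fieldType} {U V : lmodType K}.
Implicit Types a b c d : seq (U * V).

Inductive tens_eq : seq (U * V) -> seq (U * V) -> Prop :=
| tens_eq_refl a : tens_eq a a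
| tens_eq_sym a b : tens_eq a b -> tens_eq b a
| tens_eq_trans a b c : tens_eq a b -> tens_eq b c -> tens_eq a c
| tens_eq_cat a b c d : tens_eq a b -> tens_eq c d -> tens_eq (a ++ c) (b ++ d)
| tens_eq_comm a b : tens_eq (a ++ b) (b ++ a)
| tens_eq_0l v : tens_eq [:: (0, v)] [::]
| tens_eq_Dl u u' v : tens_eq [:: (u + u', v)] [:: (u, v); (u', v)]
| tens_eq_Dr u v v' : tens_eq [:: (u, v + v')] [:: (u, v); (u, v')]
| tens_eq_Z k u v : tens_eq [:: (k *: u, v)] [:: (u, k *: v)].

Definition tens_eqb : rel (seq (U * V)) := fun a b => `[< tens_eq a b >].

Lemma tens_eqb_refl : reflexive tens_eqb.
Proof. by move=> a; apply/asboolP/tens_eq_refl. Qed.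

Lemma tens_eqb_sym : symmetric tens_eqb.
Proof. by move=> a b; apply/asboolP/asboolP; apply: tens_eq_sym. Qed.

Lemma tens_eqb_trans : transitive tens_eqb.
Proof.
by move=> b a c /asboolP ab /asboolP bc; apply/asboolP; apply: tens_eq_trans bc.
Qed.

Canonical tens_equiv := EquivRel tens_eqb tens_eqb_refl tens_eqb_sym tens_eqb_trans.

Definition tens := {eq_quot tens_equiv}.
HB.instance Definition _ := Choice.on tens.
HB.instance Definition _ := EqQuotient.on tens.

Definition tens_class a : tens := \pi_tens a.

Lemma tens_classE a b : tens_eq a b -> tens_class a = tens_class b.
Proof. by move=> ab; apply/eqmodP/asboolP. Qed.

Lemma tens_class_eq a b : tens_class a = tens_class b -> tens_eq a b.
Proof. by move/eqmodP/asboolP. Qed.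

Lemma tens_classP (x : tens) : exists a, x = tens_class a.
Proof. by exists (repr x); rewrite /tens_class reprK. Qed.

Lemma tens_repr a : tens_eq (repr (tens_class a)) a.
Proof. by apply: tens_class_eq; rewrite /tens_class reprK. Qed.

Definition fscale (k : K) a : seq (U * V) := [seq (k *: p.1, p.2) | p <- a].

Lemma fscale_cat k a b : fscale k (a ++ b) = fscale k a ++ fscale k b.
Proof. exact: map_cat. Qed.

Lemma tens_eq_fscale k a b : tens_eq a b -> tens_eq (fscale k a) (fscale k b).
Proof.
elim=> {a b}.
- by move=> a; apply: tens_eq_refl.
- by move=> a b _; apply: tens_eq_sym.
- by move=> a b c _ ab _; apply: tens_eq_trans.
- by move=> a b c d _ ab _ cd; rewrite !fscale_cat; apply: tens_eq_cat.
- by move=> a b; rewrite !fscale_cat; apply: tens_eq_comm.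
- by move=> v; rewrite /fscale /= scaler0; apply: tens_eq_0l.
- by move=> u u' v; rewrite /fscale /= scalerDr; apply: tens_eq_Dl.
- by move=> u v v'; apply: tens_eq_Dr.
- by move=> l u v; rewrite /fscale /= scalerA mulrC -scalerA; apply: tens_eq_Z.
Qed.

Lemma fscaleDl k l a : tens_eq (fscale (k + l) a) (fscale k a ++ fscale l a).
Proof.
elim: a => [|[u v] a IHa] /=; first exact: tens_eq_refl.
apply: (@tens_eq_trans _ ([:: (k *: u, v); (l *: u, v)] ++
                           (fscale k a ++ fscale l a))).
  rewrite scalerDl -[X in tens_eq X]cat1s; apply: tens_eq_cat IHa.
  exact: tens_eq_Dl.
rewrite -[X in tens_eq _ X]/([:: (k *: u, v)] ++ (fscale k a ++ [:: (l *: u, v)] ++ fscale l a)).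
rewrite -[X in tens_eq X]/([:: (k *: u, v)] ++ ([:: (l *: u, v)] ++ _)).
apply: tens_eq_cat; first exact: tens_eq_refl.
rewrite !catA; apply: tens_eq_cat; last exact: tens_eq_refl.
exact: tens_eq_comm.
Qed.

Lemma fscale0 a : tens_eq (fscale 0 a) [::].
Proof.
elim: a => [|[u v] a IHa] /=; first exact: tens_eq_refl.
rewrite scale0r -[X in tens_eq X]cat1s -[X in tens_eq _ X]cat0s.
by apply: tens_eq_cat IHa; apply: tens_eq_0l.
Qed.

Lemma fscale1 a : fscale 1 a = a.
Proof. by elim: a => //= [[u v] a ->]; rewrite scale1r. Qed.

Definition tens_zero : tens := tens_class [::].
Definition tens_add (x y : tens) : tens := tens_class (repr x ++ repr y).
Definition tens_scale (k : K) (x : tens) : tens := tens_class (fscale k (repr x)).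
Definition tens_opp (x : tens) : tens := tens_scale (-1) x.

Lemma tens_addE a b :
  tens_add (tens_class a) (tens_class b) = tens_class (a ++ b).
Proof. by apply: tens_classE; apply: tens_eq_cat; apply: tens_repr. Qed.

Lemma tens_scaleE k a : tens_scale k (tens_class a) = tens_class (fscale k a).
Proof. by apply: tens_classE; apply: tens_eq_fscale; apply: tens_repr. Qed.

Lemma tens_addA : associative tens_add.
Proof.
move=> x y z; have [a ->] := tens_classP x.
have [b ->] := tens_classP y; have [c ->] := tens_classP z.
by rewrite !tens_addE catA.
Qed.

Lemma tens_addC : commutative tens_add.
Proof. by move=> x y; apply: tens_classE; apply: tens_eq_comm. Qed.

Lemma tens_add0 : left_id tens_zero tens_add.
Proof. by move=> x; have [a ->] := tens_classP x; rewrite tens_addE. Qed.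

Lemma tens_addN : left_inverse tens_zero tens_opp tens_add.
Proof.
move=> x; have [a ->] := tens_classP x.
rewrite /tens_opp tens_scaleE tens_addE; apply: tens_classE.
rewrite -[X in _ ++ X]fscale1.
apply: tens_eq_trans (fscale0 a); apply: tens_eq_sym.
by have := fscaleDl (-1) 1 a; rewrite addNr.
Qed.

HB.instance Definition _ :=
  GRing.isZmodule.Build tens tens_addA tens_addC tens_add0 tens_addN.

Lemma tens_scaleA k l x : tens_scale k (tens_scale l x) = tens_scale (k * l) x.
Proof.
have [a ->] := tens_classP x; rewrite !tens_scaleE; congr tens_class.
by rewrite /fscale -map_comp; apply: eq_map => p /=; rewrite scalerA.
Qed.

Lemma tens_scale1 : left_id 1 tens_scale.
Proof.
by move=> x; have [a ->] := tens_classP x; rewrite tens_scaleE fscale1.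
Qed.

Lemma tens_scaleDr : right_distributive tens_scale +%R.
Proof.
move=> k x y; have [a ->] := tens_classP x; have [b ->] := tens_classP y.
rewrite [X in tens_scale k X]tens_addE !tens_scaleE fscale_cat.
by rewrite [RHS]tens_addE.
Qed.

Lemma tens_scaleDl x : {morph tens_scale^~ x : k l / k + l}.
Proof.
move=> k l; have [a ->] := tens_classP x; rewrite !tens_scaleE [RHS]tens_addE.
by apply: tens_classE; apply: fscaleDl.
Qed.

HB.instance Definition _ := GRing.Zmodule_isLmodule.Build K tens
  tens_scaleA tens_scale1 tens_scaleDr tens_scaleDl.

Definition pure_tens (u : U) (v : V) : tens := tens_class [:: (u, v)].

(** The linear map induced by [f]; it is only meaningful when [f] is bilinear,
    see [tens_liftE] and [tens_lift_linear]. *)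
Definition tens_lift (W : lmodType K) (f : U -> V -> W) (x : tens) : W :=
  \sum_(p <- repr x) f p.1 p.2.

Section Lift.
Variables (W : lmodType K) (f : U -> V -> W).
Hypothesis fl : forall v, linear (f^~ v).
Hypothesis fr : forall u, linear (f u).

Lemma tens_eq_sum a b : tens_eq a b ->
  \sum_(p <- a) f p.1 p.2 = \sum_(p <- b) f p.1 p.2.
Proof.
have fD u u' v : f (u + u') v = f u v + f u' v.
  by have := fl v 1 u u'; rewrite !scale1r.
have fD' u v v' : f u (v + v') = f u v + f u v'.
  by have := fr u 1 v v'; rewrite !scale1r.
have f0 v : f 0 v = 0 by apply: (addrI (f 0 v)); rewrite -fD !addr0.
have f0' u : f u 0 = 0 by apply: (addrI (f u 0)); rewrite -fD' !addr0.
elim=> {a b} //=.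
- by move=> a b c _ -> _ ->.
- by move=> a b c d _ ab _ cd; rewrite !big_cat /= ab cd.
- by move=> a b; rewrite !big_cat /= addrC.
- by move=> v; rewrite big_cons !big_nil f0 addr0.
- by move=> u u' v; rewrite !big_cons !big_nil /= fD !addr0.
- by move=> u v v'; rewrite !big_cons !big_nil /= fD' !addr0.
- move=> k u v; rewrite !big_cons !big_nil /= !addr0.
  have := fl v k u 0; have := fr u k v 0.
  by rewrite !addr0 f0 f0' !addr0 => -> ->.
Qed.

Lemma tens_liftE u v : tens_lift f (pure_tens u v) = f u v.
Proof.
by rewrite /tens_lift (tens_eq_sum (tens_repr _)) big_cons big_nil addr0.
Qed.

Lemma tens_lift_linear : linear (tens_lift f).
Proof.
move=> k x y; have [a ->] := tens_classP x; have [b ->] := tens_classP y.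
rewrite /tens_lift.
have -> : k *: tens_class a + tens_class b = tens_class (fscale k a ++ b).
  by rewrite [k *: _]tens_scaleE [LHS]tens_addE.
rewrite !(tens_eq_sum (tens_repr _)) big_cat /= scaler_sumr big_map.
congr (_ + _); apply: eq_bigr => p _ /=.
have f0 v : f 0 v = 0.
  by apply: (addrI (f 0 v)); have := fl v 1 0 0; rewrite !scale1r !addr0.
by have := fl p.2 k p.1 0; rewrite !addr0 f0 addr0.
Qed.

End Lift.
End TensorProduct.

Arguments tens {K} U V.
Notation "u ⊗ v" := (pure_tens u v) (at level 40, left associativity).

Section MatrixOver.
Context {C : numClosedFieldType} {V W : lmodType C}.

Definition diag_cst n (x : V) : 'M[V]_n :=
  \matrix_(i, j) (if i == j then x else 0).

(** [a X a^*], for a scalar matrix [a] and a matrix [X] of vectors *)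
Definition compression n k (a : 'M[C]_(n, k)) (X : 'M[V]_k) : 'M[V]_n :=
  \matrix_(i, j) \sum_p \sum_q (a i p * (a j q)^*) *: X p q.

(** Kronecker product, with the same indexing as [tensmx] *)
Definition kron k m (P : 'M[V]_k) (Q : 'M[W]_m) : 'M[tens V W]_(k * m) :=
  \matrix_(i, j) (P (mxtens_unindex i).1 (mxtens_unindex j).1
                  ⊗ Q (mxtens_unindex i).2 (mxtens_unindex j).2).

End MatrixOver.

(** [mo_pos n] is the set of positive elements of [M_n(V)]. No axioms are
    required here: the record only serves to speak uniformly of maps between
    operator systems, matrix algebras and tensor products. *)

Record mospace (C : numClosedFieldType) := MOSpace {
  mo_sort :> lmodType C;
  mo_unit : mo_sort;
  mo_pos : forall n, set 'M[mo_sort]_n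
}.

Section Maps.
Context {C : numClosedFieldType} {V W : mospace C}.

Definition unital (f : V -> W) := f (mo_unit V) = mo_unit W.

Definition completely_positive (f : V -> W) :=
  forall n (X : 'M[V]_n), mo_pos X -> mo_pos (map_mx f X).

Definition ucp (f : V -> W) := unital f /\ completely_positive f.

Definition complete_order_embedding (f : V -> W) :=
  injective f /\ forall n (X : 'M[V]_n), mo_pos X <-> mo_pos (map_mx f X).

End Maps.

Definition complete_order_iso (C : numClosedFieldType) (V W : mospace C)
    (f : {linear V -> W}) :=
  exists g : {linear W -> V}, [/\ cancel f g, cancel g f,
    completely_positive f & completely_positive g].

(** [M_k], with [M_n(M_k)] acting on the direct sum of [n] copies of [C^k] *)
Definition matrix_mospace (C : numClosedFieldType) (k : nat) : mospace C :=
  @MOSpace C 'M[C]_k 1%:M (fun n => [set X : 'M['M[C]_k]_n |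
    forall v : 'I_n -> 'cV[C]_k,
      0 <= \sum_i \sum_j ((map_mx Num.conj (v i))^T *m X i j *m v j) 0 0]).

Record hilbertType (C : numClosedFieldType) := HilbertType {
  hilbert_sort :> completeNormedModType C;
  inner : {dot hilbert_sort for Num.conj};
  inner_norm : forall x, inner x x = `|x| ^+ 2
}.

Section BoundedOperators.
Context {C : numClosedFieldType}.

Definition bounded_op (H : hilbertType C) : {pred H -> H} :=
  [pred f | `[< linear f /\ exists M : C, forall x, `|f x| <= M * `|x| >]].

Lemma bounded_op_submod (H : hilbertType C) : submod_closed (@bounded_op H).
Proof.
split.
  apply/asboolP; split; first by move=> k x y; rewrite scaler0 addr0.
  by exists 0 => x; rewrite mul0r normr0.
move=> k f g /asboolP[flin [M fM]] /asboolP[glin [N gN]]; apply/asboolP; split.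
  move=> l x y; rewrite !fctE flin glin !scalerDr !scalerA (mulrC k l).
  by rewrite addrACA.
exists (`|k| * M + N) => x; rewrite mulrDl -mulrA.
apply: le_trans (ler_normD _ _) _; apply: lerD; last exact: gN.
by rewrite normrZ; apply: ler_wpM2l => //; apply: fM.
Qed.

HB.instance Definition _ (H : hilbertType C) :=
  GRing.isSubmodClosed.Build C (H -> H) (@bounded_op H) (bounded_op_submod H).

Definition bop (H : hilbertType C) := {f : H -> H | f \in @bounded_op H}.

HB.instance Definition _ (H : hilbertType C) := SubType.on (bop H).
HB.instance Definition _ (H : hilbertType C) := Choice.on (bop H).
HB.instance Definition _ (H : hilbertType C) :=
  [SubChoice_isSubLmodule of bop H by <:].

Definition bop_fun H (a : bop H) : H -> H := val a.
Coercion bop_fun : bop >-> Funclass.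

Lemma bop_id_subproof (H : hilbertType C) : (id : H -> H) \in @bounded_op H.
Proof. by apply/asboolP; split=> //; exists 1 => x; rewrite mul1r. Qed.

Definition bop_id H : bop H := Sub id (bop_id_subproof H).

(** A relation rather than an operation: the existence of adjoints (Riesz) is
    not in the library. *)
Definition is_adjoint (H : hilbertType C) (a b : bop H) :=
  forall x y, inner H (a x) y = inner H x (b y).

Definition opnorm_le (H : hilbertType C) (a : bop H) (e : C) :=
  forall x, `|a x| <= e * `|x|.

Definition norm_closure (H : hilbertType C) (A : set (bop H)) : set (bop H) :=
  [set a | forall e : C, 0 < e -> exists2 b, A b & opnorm_le (a - b) e].

End BoundedOperators.

Record opsys (C : numClosedFieldType) := OpSys {
  os_hilbert : hilbertType C;
  os_space : submodClosed (bop os_hilbert);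
  os_unital : bop_id os_hilbert \in os_space;
  os_selfadjoint : forall a, a \in os_space ->
    exists2 b, b \in os_space & is_adjoint a b
}.

Section OperatorSystems.
Context {C : numClosedFieldType}.

Definition os_sort (S : opsys C) := {a : bop (os_hilbert S) | a \in os_space S}.

HB.instance Definition _ (S : opsys C) := SubType.on (os_sort S).
HB.instance Definition _ (S : opsys C) := Choice.on (os_sort S).
HB.instance Definition _ (S : opsys C) := [SubChoice_isSubLmodule of os_sort S by <:].

Definition os_op (S : opsys C) (s : os_sort S) : bop (os_hilbert S) := val s.

Definition os_one (S : opsys C) : os_sort S := Sub (bop_id _) (os_unital S).

(** [M_n(S)] acts on the direct sum of [n] copies of the Hilbert space *)
Definition os_pos (S : opsys C) n : set 'M[os_sort S]_n :=
  [set X | forall v : 'I_n -> os_hilbert S,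
    0 <= \sum_i \sum_j inner _ (os_op (X i j) (v j)) (v i)].

Definition os_mospace (S : opsys C) : mospace C :=
  MOSpace (os_one S) (@os_pos S).
Coercion os_mospace : opsys >-> mospace.

Definition norm_closed (S : opsys C) :=
  norm_closure [set a | a \in os_space S] `<=` [set a | a \in os_space S].

(** An operator system tensor product is given by its matrix cones, the unit
    being [1 ⊗ 1]. *)
Definition tensor_cones :=
  forall (S T : opsys C) (n : nat), set 'M[tens S T]_n.

Definition tensor_mospace (alpha : tensor_cones) (S T : opsys C) : mospace C :=
  MOSpace (mo_unit S ⊗ mo_unit T) (alpha S T).

Definition min_cones : tensor_cones := fun S T n =>
  [set u | forall k m (phi : {linear S -> matrix_mospace C k})
                      (psi : {linear T -> matrix_mospace C m}),
    ucp phi -> ucp psi ->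
    @mo_pos _ (matrix_mospace C (k * m)) n
      (map_mx (tens_lift (fun s t => phi s *t psi t)) u)].

Definition max_precones : tensor_cones := fun S T n =>
  [set u | exists k m (P : 'M[S]_k) (Q : 'M[T]_m) (a : 'M[C]_(n, k * m)),
    [/\ mo_pos P, mo_pos Q & u = compression a (kron P Q)]].

Definition max_cones : tensor_cones := fun S T n =>
  [set u | forall e : C, 0 < e ->
    max_precones (u + diag_cst n (e *: (mo_unit S ⊗ mo_unit T)))].

Definition nuclear (alpha beta : tensor_cones) (S : opsys C) :=
  forall T : opsys C,
    complete_order_iso
      (idfun : {linear tensor_mospace alpha S T -> tensor_mospace beta S T}).

Definition inductive_system (S : nat -> opsys C)
    (u : forall n, {linear S n -> S n.+1}) :=
  forall n, unital (u n) /\ complete_order_embedding (u n).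

(** Since [norm_closure] is taken in [B(H)], the limit is norm closed; the
    universal property is accordingly stated for norm closed targets. *)
Record inductive_limit (S : nat -> opsys C)
    (u : forall n, {linear S n -> S n.+1})
    (L : opsys C) (lam : forall n, {linear S n -> L}) : Prop := {
  lim_unital : forall n, unital (lam n);
  lim_embedding : forall n, complete_order_embedding (lam n);
  lim_compat : forall n x, lam n x = lam n.+1 (u n x);
  lim_dense : [set a | a \in os_space L] =
    norm_closure (\bigcup_n range (fun x : S n => os_op (lam n x)));
  lim_universal : forall (T : opsys C) (phi : forall n, {linear S n -> T}),
    norm_closed T ->
    (forall n, ucp (phi n)) ->
    (forall n x, phi n x = phi n.+1 (u n x)) ->
    exists psi : {linear L -> T},
      [/\ ucp psi, forall n x, psi (lam n x) = phi n x &
          forall psi' : {linear L -> T}, ucp psi' ->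
            (forall n x, psi' (lam n x) = phi n x) -> psi' =1 psi]
}.

End OperatorSystems.

(* Main.v *)
Require Import Defs.
From HB Require Import structures.
From mathcomp Require Import all_boot all_order all_algebra.
From mathcomp Require Import all_classical all_reals.
From mathcomp Require Import topology normedtype.
From mathcomp Require Import complex mxtens ring ssrAC.

(** Let [L] be the limit of the [S_n] and [T] any operator system. The maximal
    cones always lie in the minimal ones ([max_cones_min]), so a minimal positive
    [X] over [L ⊗ T] and [e > 0] are given, and [X + e] has to be written as a
    generator [a (P ⊗ Q) a^*] of the maximal cones.

    The natural idea is to approximate [X] by the image [Y] of a tensor over some
    [S_N ⊗ T], to apply nuclearity of [S_N] there, and to push the result forward.
    Two points need care.

    First, [Y + e/3] must be minimal positive over [S_N ⊗ T], while only its
    positivity over [L ⊗ T] is known, and a completely positive map on [S_N] has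
    to be compared with maps on [L]. Instead of extending such maps, the minimal
    cones are identified with the cones of the spatial tensor product
    ([min_conesP]): minimal positive elements are spatially positive because
    compressions to finite-dimensional subspaces are unital completely positive
    ([min_spatial_pos]), and conversely complete positivity is applied to one
    factor at a time ([spatial_pos_min]). The latter argument only uses matrices
    over the left factor and is thus insensitive to complete order embeddings.

    Second, [X - Y] must be absorbed by [e/3] in the order of the maximal cones.
    This is only possible for hermitian elements, so [X] is first represented as a
    sum of [A ⊗ t] with [A] and [t] hermitian ([spatial_pos_herm]), which rests on
    the faithfulness of the spatial form on the algebraic tensor product
    ([tens_faithful]). Each [A] is then approximated by a hermitian matrix coming
    from a stage of the system ([dense_herm_mx]), and the error [Z ⊗ t] is
    absorbed by an explicit identity ([max_precones_small]).

    For the generators themselves, the entrywise description [max_preconesP] makes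
    sums easy, and their spatial positivity is the Schur product theorem
    ([max_precones_spatial_pos]). *)

Set Implicit Arguments.
Unset Strict Implicit.
Unset Printing Implicit Defensive.

Import Order.TTheory GRing.Theory Num.Theory.
Import numFieldNormedType.Exports.

Local Open Scope ring_scope.

(** * Scalar facts *)
Section Polarization.
Context {C : numClosedFieldType}.
Implicit Types a b : C.

(** Evaluating a real quadratic form at [x + y] and at [x + i y] yields these
    two conditions on its off-diagonal values [a] and [b]. *)
Lemma real_polarization a b :
  a + b \is Num.real -> 'i * a - 'i * b \is Num.real -> b = a^*.
Proof.
move=> /CrealP h1 /CrealP.
rewrite rmorphB !rmorphM /= !conjCi !mulNr opprK => h2.
have {}h2 : b^* - a^* = a - b.
  apply: (mulfI (neq0Ci C)); rewrite !mulrBr -h2 addrC; congr (_ + _).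
move: h1; rewrite rmorphD /= => h1.
have : (b^* *+ 2) = a *+ 2.
  have -> : b^* *+ 2 = (b^* - a^*) + (a^* + b^*) by rewrite addrA subrK mulr2n.
  by rewrite h2 h1 addrACA addNr addr0 mulr2n.
by move/eqP; rewrite eqrMn2r // => /eqP <-; rewrite conjCK.
Qed.

Lemma ge0_limit a b : 0 <= b -> (forall e, 0 < e -> 0 <= a + e * b) -> 0 <= a.
Proof.
rewrite le_eqVlt => /predU1P[<- h|b0 h].
  by have := h 1 ltr01; rewrite mulr0 addr0.
apply/ler_addgt0Pr => e e0.
by have := h (e / b) (divr_gt0 e0 b0); rewrite divfK // gt_eqF.
Qed.

End Polarization.

Section FiniteSums.
Context {V : nmodType}.

Lemma sum_enum (I : finType) (F : I -> V) :
  \sum_(i < #|I|) F (enum_val i) = \sum_i F i.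
Proof. by rewrite [RHS](reindex _ (onW_bij _ (@enum_val_bij I))). Qed.

Lemma sum_enum2 (I : finType) (F : I -> I -> V) :
  \sum_(i < #|I|) \sum_(j < #|I|) F (enum_val i) (enum_val j)
    = \sum_i \sum_j F i j.
Proof.
rewrite -[RHS]sum_enum; apply: eq_bigr => i _.
exact: (sum_enum (F (enum_val i))).
Qed.

End FiniteSums.

(** * Sesquilinear forms of operator system elements *)
Section ElementForm.
Context {C : numClosedFieldType}.

Section Inner.
Variable H : hilbertType C.
Implicit Types x y z : H.
Local Notation "<< x , y >>" := (inner H x y).

Lemma innerDl x y z : << x + y, z >> = << x, z >> + << y, z >>.
Proof. exact: linearDl. Qed.
Lemma innerDr x y z : << x, y + z >> = << x, y >> + << x, z >>.
Proof. exact: linearDr. Qed.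
Lemma innerZl k x y : << k *: x, y >> = k * << x, y >>.
Proof. exact: linearZl_LR. Qed.
Lemma innerZr k x y : << x, k *: y >> = k^* * << x, y >>.
Proof. exact: linearZr_LR. Qed.
Lemma innerC x y : << y, x >> = (<< x, y >>)^*.
Proof. by rewrite hermC /= expr0 mul1r. Qed.
Lemma inner0l x : << 0, x >> = 0. Proof. exact: linear0l. Qed.
Lemma inner_suml (I : Type) (r : seq I) (P : pred I) (F : I -> H) y :
  << \sum_(i <- r | P i) F i, y >> = \sum_(i <- r | P i) << F i, y >>.
Proof.
by apply: (big_morph (fun x => << x, y >>)) => [x x'|];
  rewrite (innerDl, inner0l).
Qed.
Lemma inner_sumr (I : Type) (r : seq I) (P : pred I) (F : I -> H) y :
  << y, \sum_(i <- r | P i) F i >> = \sum_(i <- r | P i) << y, F i >>.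
Proof. exact: (linear_sumr (inner H)). Qed.

(** Expand the square of [x - w y], where [w] is the phase of [<x, y>]. This
    additive form of Cauchy-Schwarz suits the estimates below, which are
    summed over the entries of a matrix. *)
Lemma inner_bound x y : `|<< x, y >>| *+ 2 <= `|x| ^+ 2 + `|y| ^+ 2.
Proof.
have [->|nz] := eqVneq << x, y >> 0.
  by rewrite normr0 mul0rn addr_ge0 // exprn_ge0.
pose w := << x, y >> / `|<< x, y >>|.
have nn : `|<< x, y >>| != 0 by rewrite normr_eq0.
have w1 : `|w| = 1 by rewrite normf_div normr_id divff.
have := dnorm_ge0 (inner H) (x - w *: y).
rewrite dnormB dnormZ w1 expr1n mul1r !inner_norm innerZr.
have -> : w^* * << x, y >> = `|<< x, y >>|.
  rewrite /w rmorphM /= fmorphV /= [(`|_|)^*]conj_Creal ?normr_real //.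
  by rewrite mulrAC [_^* * _]mulrC -normCK expr2 mulfK.
by rewrite conj_Creal ?normr_real // subr_ge0 mulr2n.
Qed.

End Inner.

Section Elements.
Variable S : opsys C.
Local Notation H := (os_hilbert S).
Implicit Types (s t : S) (x y : H).

(** Positivity, adjoints and norm estimates are all read off these forms. *)
Definition sform s x y : C := inner _ (os_op s x) y.

Lemma os_op_linear s : linear (os_op s : H -> H).
Proof. by have /asboolP[] := valP (os_op s). Qed.

Lemma os_opD s t x : os_op (s + t) x = os_op s x + os_op t x.
Proof. by []. Qed.

Lemma os_opZ k s x : os_op (k *: s) x = k *: os_op s x.
Proof. by []. Qed.

Lemma sformDl s t x y : sform (s + t) x y = sform s x y + sform t x y.
Proof. by rewrite /sform os_opD innerDl. Qed.

Lemma sformZl k s x y : sform (k *: s) x y = k * sform s x y.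
Proof. by rewrite /sform os_opZ innerZl. Qed.

Lemma sform0l x y : sform 0 x y = 0.
Proof. by rewrite -(scale0r (0 : S)) sformZl mul0r. Qed.

Lemma sformNl s x y : sform (- s) x y = - sform s x y.
Proof. by rewrite -scaleN1r sformZl mulN1r. Qed.

Lemma sformBl s t x y : sform (s - t) x y = sform s x y - sform t x y.
Proof. by rewrite sformDl sformNl. Qed.

Lemma sform_suml (I : Type) (r : seq I) (F : I -> S) x y :
  sform (\sum_(i <- r) F i) x y = \sum_(i <- r) sform (F i) x y.
Proof.
by apply: (big_morph (fun s => sform s x y)) => [s t|];
  rewrite (sformDl, sform0l).
Qed.

Lemma sformDr s x x' y : sform s (x + x') y = sform s x y + sform s x' y.
Proof.
rewrite /sform -innerDl; congr (inner _ _ _).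
by have := os_op_linear s 1 x x'; rewrite !scale1r.
Qed.

Lemma os_op0 s : os_op s 0 = 0.
Proof.
by apply: (addrI (os_op s 0)); have := os_op_linear s 1 0 0; rewrite !scale1r !addr0.
Qed.

Lemma sform0r s y : sform s 0 y = 0.
Proof. by rewrite /sform os_op0 inner0l. Qed.

Lemma sformZr s k x y : sform s (k *: x) y = k * sform s x y.
Proof.
rewrite /sform -innerZl; congr (inner _ _ _).
by have := os_op_linear s k x 0; rewrite !addr0 os_op0 addr0.
Qed.

Lemma sform_sumr (I : Type) (r : seq I) (P : pred I) (F : I -> H) s y :
  sform s (\sum_(i <- r | P i) F i) y = \sum_(i <- r | P i) sform s (F i) y.
Proof.
by apply: (big_morph (fun x => sform s x y)) => [x x'|];
  rewrite (sformDr, sform0r).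
Qed.

Lemma sform_conjZ s k x y : sform s x (k *: y) = k^* * sform s x y.
Proof. exact: innerZr. Qed.

Lemma sform_conj_sum (I : Type) (r : seq I) (P : pred I) (F : I -> H) s x :
  sform s x (\sum_(i <- r | P i) F i) = \sum_(i <- r | P i) sform s x (F i).
Proof. exact: inner_sumr. Qed.

Lemma sform1 x y : sform (mo_unit S) x y = inner _ x y.
Proof. by []. Qed.

(** A bounded operator is determined by its form: take [y] to be the image
    of [x]. *)
Lemma sform_sep s : (forall x y, sform s x y = 0) -> s = 0.
Proof.
move=> h; apply: val_inj; apply: val_inj; apply/funext => x.
have /eqP := h x (os_op s x); rewrite dnorm_eq0 => /eqP.
by rewrite /os_op /bop_fun => ->.
Qed.

Lemma sform_adjoint s : exists s', forall x y, sform s' x y = (sform s y x)^*.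
Proof.
have [b bS sb] := os_selfadjoint (valP s).
exists (Sub b bS : os_sort S) => x y; rewrite /sform.
have -> : inner _ (os_op s y) x = inner _ y (bop_fun b x) by exact: sb y x.
by rewrite -innerC.
Qed.

Lemma sform_bounded s : exists2 c : C, 0 <= c &
  forall x y, `|sform s x y| <= c * (`|x| ^+ 2 + `|y| ^+ 2).
Proof.
have /asboolP[_ [M sM]] := valP (os_op s).
exists (`|M| ^+ 2 + 1) => [|x y]; first by rewrite addr_ge0 ?exprn_ge0.
have := inner_bound (os_op s x) y.
move=> h; apply: le_trans (_ : `|sform s x y| *+ 2 <= _).
  by rewrite mulr2n lerDl.
apply: le_trans h _.
have hx : `|os_op s x| <= `|M| * `|x|.
  apply: le_trans (sM x) _.
  have : 0 <= M * `|x| by apply: le_trans (sM x).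
  by move/ger0_norm => <-; rewrite normrM normr_id.
have : `|os_op s x| ^+ 2 <= (`|M| * `|x|) ^+ 2.
  by apply: lerXn2r; rewrite ?nnegrE ?mulr_ge0.
rewrite exprMn => h2; rewrite mulrDr; apply: lerD.
  apply: le_trans h2 _; apply: ler_wpM2r; rewrite ?exprn_ge0 //.
  by rewrite lerDl.
by rewrite mulrDl mul1r lerDr mulr_ge0 ?exprn_ge0.
Qed.

Lemma sform_small s (d : C) : 0 < d -> opnorm_le (os_op s) d ->
  forall x y, `|sform s x y| <= d * (`|x| ^+ 2 + `|y| ^+ 2).
Proof.
move=> d0 sd x y.
have -> : sform s x y = d * inner _ (d^-1 *: os_op s x) y.
  by rewrite innerZl mulVKf // gt_eqF.
rewrite normrM (gtr0_norm d0) ler_pM2l //.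
apply: le_trans (_ : `|inner _ (d^-1 *: os_op s x) y| *+ 2 <= _).
  by rewrite mulr2n lerDl.
apply: le_trans (inner_bound _ _) _; rewrite lerD2r.
apply: lerXn2r; rewrite ?nnegrE // normrZ normfV (gtr0_norm d0).
by rewrite mulrC ler_pdivrMr // mulrC; apply: sd.
Qed.

End Elements.
End ElementForm.

(** * Quadratic forms of scalar matrices *)
Section MatrixForms.
Context {C : numClosedFieldType}.

Definition mxform n (M : 'M[C]_n) (z y : 'cV[C]_n) : C :=
  ((map_mx Num.conj y)^T *m M *m z) 0 0.

Lemma mxformE n (M : 'M[C]_n) z y :
  mxform M z y = \sum_p \sum_q (y p 0)^* * M p q * z q 0.
Proof.
rewrite /mxform mxE exchange_big /=; apply: eq_bigr => q _.
rewrite mxE mulr_suml; apply: eq_bigr => p _.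
by rewrite !mxE.
Qed.

Lemma mxform_sum n (A : Type) (r : seq A) (F : A -> 'M[C]_n) z y :
  mxform (\sum_(a <- r) F a) z y = \sum_(a <- r) mxform (F a) z y.
Proof. by rewrite /mxform mulmx_sumr mulmx_suml summxE. Qed.

Lemma mxform_sumr n (M : 'M[C]_n) (A : Type) (r : seq A) (P : pred A) F y :
  mxform M (\sum_(a <- r | P a) F a) y = \sum_(a <- r | P a) mxform M (F a) y.
Proof. by rewrite /mxform mulmx_sumr summxE. Qed.

Lemma mxform_conj_sum n (M : 'M[C]_n) (A : Type) (r : seq A) (P : pred A) F z :
  mxform M z (\sum_(a <- r | P a) F a) = \sum_(a <- r | P a) mxform M z (F a).
Proof.
by rewrite /mxform raddf_sum /= raddf_sum /= !mulmx_suml summxE.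
Qed.

Definition col_tens k m (z : 'cV[C]_k) (w : 'cV[C]_m) : 'cV[C]_(k * m) :=
  \col_s (z (mxtens_unindex s).1 0 * w (mxtens_unindex s).2 0).

(** The matrix counterpart of the product rule for the form of an elementary
    tensor. *)
Lemma mxform_tens k m (A : 'M[C]_k) (B : 'M[C]_m) z y z' y' :
  mxform (A *t B) (col_tens z z') (col_tens y y') = mxform A z y * mxform B z' y'.
Proof.
rewrite !mxformE mulr_sum; apply: eq_bigr => s _.
rewrite mulr_sum; apply: eq_bigr => t _.
rewrite !mxE rmorphM /= [X in X * (z _ _ * _)]mulrACA [LHS]mulrACA.
by congr (_ * _ * _ * (_ * _ * _)).
Qed.

(** Splitting a vector along the standard basis of the left factor only, the
    right components stay arbitrary vectors; thus one slot of a tensor can be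
    treated after the other. *)
Lemma col_tens_decomp k m (v : 'cV[C]_(k * m)) :
  v = \sum_p col_tens (delta_mx p 0) (\col_r v (mxtens_index (p, r)) 0).
Proof.
apply/matrixP => s j; rewrite ord1 {j} summxE.
case: (mxtens_indexP s) => p r; rewrite (bigD1 p) //= big1 => [|q /negPf qp].
  by rewrite addr0 !mxE mxtens_indexK /= eqxx mul1r.
by rewrite !mxE mxtens_indexK /= eq_sym qp mul0r.
Qed.

End MatrixForms.

(** * Positive matrices over finite index types *)
Section Families.
Context {C : numClosedFieldType}.

Section Positive.
Variables (S : opsys C) (I : finType).

(** Square matrices over [S] indexed by an arbitrary finite type: index sets
    which are products or sums then need no arithmetic on ordinals. *)
Definition qform (P : I -> I -> S) (x : I -> os_hilbert S) : C :=
  \sum_i \sum_j sform (P i j) (x j) (x i).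

Definition pos_fam (P : I -> I -> S) := forall x, 0 <= qform P x.

Definition ord_mx (V : Type) (P : I -> I -> V) : 'M[V]_#|I| :=
  \matrix_(i, j) P (enum_val i) (enum_val j).

Lemma pos_fam_ord_mx P : pos_fam P <-> @mo_pos _ S #|I| (ord_mx P).
Proof.
split=> h x.
  suff -> : \sum_i \sum_j inner _ (os_op (ord_mx P i j) (x j)) (x i)
      = qform P (x \o enum_rank) by apply: h.
  rewrite /qform -(sum_enum2 (fun i j => sform (P i j) _ _)).
  by apply: eq_bigr => i _; apply: eq_bigr => j _; rewrite mxE /= !enum_valK.
have := h (x \o enum_val); congr (0 <= _).
rewrite /qform -(sum_enum2 (fun i j => sform (P i j) _ _)).
by apply: eq_bigr => i _; apply: eq_bigr => j _; rewrite mxE.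
Qed.

End Positive.

Lemma pos_fam_mx (S : opsys C) n (X : 'M[S]_n) :
  @mo_pos _ S n X <-> pos_fam (fun i j => X i j).
Proof. by []. Qed.

Lemma map_ord_mx (I : finType) (V W : Type) (f : V -> W) (P : I -> I -> V) :
  map_mx f (ord_mx P) = ord_mx (fun i j => f (P i j)).
Proof. by apply/matrixP => i j; rewrite !mxE. Qed.

Section Maps.
Variables (S T : opsys C) (I : finType) (P : I -> I -> S).

(** Complete positivity speaks of ordinal indices; an enumeration of [I]
    carries it over to arbitrary finite index types. *)
Lemma cp_pos_fam (f : S -> T) : completely_positive f ->
  pos_fam P -> pos_fam (fun i j => f (P i j)).
Proof.
move=> fcp /pos_fam_ord_mx h; apply/pos_fam_ord_mx.
by rewrite -(map_ord_mx f); apply: fcp.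
Qed.

Lemma embedding_pos_fam (f : S -> T) : complete_order_embedding f ->
  pos_fam (fun i j => f (P i j)) -> pos_fam P.
Proof.
move=> [_ fe] /pos_fam_ord_mx h; apply/pos_fam_ord_mx/fe.
by rewrite (map_ord_mx f).
Qed.

Lemma cp_matrix_fam k (phi : S -> matrix_mospace C k) (v : I -> 'cV_k) :
  completely_positive phi -> pos_fam P ->
  0 <= \sum_i \sum_j mxform (phi (P i j)) (v j) (v i).
Proof.
move=> pcp /pos_fam_ord_mx /pcp; rewrite map_ord_mx => h.
have := h (v \o enum_val); congr (0 <= _).
rewrite -(sum_enum2 (fun i j => mxform (phi (P i j)) (v j) (v i))).
apply: eq_bigr => i _; apply: eq_bigr => j _.
by congr (mxform _ _ _); rewrite mxE.
Qed.

End Maps.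
End Families.

(** * Compressions to finite-dimensional subspaces *)
Section OrthonormalCompression.
Context {C : numClosedFieldType}.

(** Gram-Schmidt on a finite list; a vector already in the span of the others
    leaves the orthonormal family unchanged. *)
Lemma orthonormal_seq (H : hilbertType C) (s : seq H) :
  exists k (e : 'I_k -> H),
    (forall p q, inner H (e p) (e q) = (p == q)%:R) /\
    (forall x, x \in s -> exists c : 'I_k -> C, x = \sum_p c p *: e p).
Proof.
elim: s => [|x s [k [e [eo es]]]].
  by exists 0, (fun _ => 0); split=> // -[].
pose r := x - \sum_p inner H x (e p) *: e p.
have re q : inner H r (e q) = 0.
  rewrite /r innerDl -scaleN1r innerZl inner_suml.
  rewrite (bigD1 q) //= big1 => [|p /negPf pq]; last first.
    by rewrite innerZl eo pq mulr0.
  by rewrite innerZl eo eqxx mulr1 addr0 mulN1r subrr.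
have [r0|r0] := eqVneq r 0.
  exists k, e; split=> // y; rewrite inE => /predU1P[->|/es //].
  by exists (fun p => inner H x (e p)); apply/eqP; rewrite -subr_eq0; apply/eqP.
have nr : `|r| != 0 by rewrite normr_eq0.
pose e' (p : 'I_k.+1) := if unlift ord0 p is Some q then e q else `|r|^-1 *: r.
have e'0 : e' ord0 = `|r|^-1 *: r by rewrite /e' unlift_none.
have e'S q : e' (lift ord0 q) = e q by rewrite /e' liftK.
exists k.+1, e'; split.
  move=> p q; case: (unliftP ord0 p) => [p'|] ->;
    case: (unliftP ord0 q) => [q'|] ->; rewrite ?e'0 ?e'S.
  - by rewrite eo (inj_eq lift_inj).
  - by rewrite innerZr innerC re conjC0 mulr0.
  - by rewrite innerZl re mulr0.
  rewrite innerZl innerZr inner_norm fmorphV /= conj_Creal ?normr_real //.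
  by rewrite expr2 mulKf // mulVf.
have main (y z : H) b (c : 'I_k -> C) : y = \sum_p c p *: e p -> z = b *: r + y ->
    exists c' : 'I_k.+1 -> C, z = \sum_p c' p *: e' p.
  move=> yc ->; exists (fun p => if unlift ord0 p is Some q then c q else b * `|r|).
  rewrite big_ord_recl unlift_none e'0 scalerA mulfK // yc; congr (_ + _).
  by apply: eq_bigr => q _; rewrite liftK e'S.
move=> y; rewrite inE => /predU1P[->|/es [c yc]].
  apply: (main _ _ 1 (fun p => inner H x (e p)) erefl).
  by rewrite scale1r /r subrK.
by apply: (main y _ 0 c yc); rewrite scale0r add0r.
Qed.

Lemma orthonormal_coordinates (H : hilbertType C) (I : finType) (x : I -> H) :
  exists k (e : 'I_k -> H) (c : I -> 'cV[C]_k),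
    (forall p q, inner H (e p) (e q) = (p == q)%:R) /\
    forall i, x i = \sum_p c i p 0 *: e p.
Proof.
have [k [e [eo es]]] := orthonormal_seq [seq x i | i <- enum I].
have h i : {c : 'cV[C]_k | x i = \sum_p c p 0 *: e p}.
  apply: cid; have [|c xc] := es (x i); first by apply/map_f; rewrite mem_enum.
  by exists (\col_p c p); rewrite xc; apply: eq_bigr => p _; rewrite mxE.
by exists k, e, (fun i => sval (h i)); split=> // i; case: (h i).
Qed.

Section Compression.
Variables (S : opsys C) (k : nat) (e : 'I_k -> os_hilbert S).

Definition compress (s : S) : matrix_mospace C k :=
  \matrix_(p, q) sform s (e q) (e p).

Lemma compress_linear : linear compress.
Proof.
by move=> a s t; apply/matrixP => p q; rewrite !mxE sformDl sformZl.
Qed.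

HB.instance Definition _ := GRing.isLinear.Build C S (matrix_mospace C k) _
  compress compress_linear.

Lemma mxform_compress s (z y : 'cV_k) : mxform (compress s) z y
  = sform s (\sum_q z q 0 *: e q) (\sum_p y p 0 *: e p).
Proof.
rewrite mxformE sform_conj_sum; apply: eq_bigr => p _.
rewrite sform_sumr; apply: eq_bigr => q _.
by rewrite sform_conjZ sformZr mxE mulrA mulrAC.
Qed.

(** Orthonormality is what makes the compression unital. *)
Lemma compress_ucp : (forall p q, inner _ (e p) (e q) = (p == q)%:R) ->
  ucp compress.
Proof.
move=> eo; split.
  by apply/matrixP => p q; rewrite !mxE sform1 eo eq_sym.
move=> n X Xpos v.
have := Xpos (fun i => \sum_p v i p 0 *: e p); congr (0 <= _).
apply: eq_bigr => i _; apply: eq_bigr => j _.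
transitivity (mxform (compress (X i j)) (v j) (v i)).
  by rewrite mxform_compress.
by congr (mxform _ _ _); rewrite mxE.
Qed.

End Compression.
End OrthonormalCompression.

(** * Spatial positivity of tensors and the minimal cones *)
Section TensorGeneralities.
Context {K : fieldType} {U V : lmodType K}.

(** The tensors of a representing list add up to [x], so linear statements
    may be checked on elementary tensors. *)
Lemma tens_sum (x : tens U V) : x = \sum_(p <- repr x) p.1 ⊗ p.2.
Proof.
rewrite -{1}[x]reprK; elim: (repr x) => [|[u v] a IHa].
  by rewrite big_nil.
by rewrite big_cons -IHa; symmetry; apply: tens_addE.
Qed.

Lemma pure_tensDl u u' (v : V) : (u + u') ⊗ v = u ⊗ v + u' ⊗ v :> tens U V.
Proof.
by transitivity (tens_class [:: (u, v); (u', v)]);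
  [apply/tens_classE/tens_eq_Dl | rewrite [RHS]tens_addE].
Qed.

Lemma pure_tensDr (u : U) v v' : u ⊗ (v + v') = u ⊗ v + u ⊗ v' :> tens U V.
Proof.
by transitivity (tens_class [:: (u, v); (u, v')]);
  [apply/tens_classE/tens_eq_Dr | rewrite [RHS]tens_addE].
Qed.

Lemma pure_tensZl k (u : U) (v : V) : (k *: u) ⊗ v = k *: (u ⊗ v) :> tens U V.
Proof. by rewrite [RHS]tens_scaleE. Qed.

Lemma pure_tensZr k (u : U) (v : V) : u ⊗ (k *: v) = k *: (u ⊗ v) :> tens U V.
Proof.
rewrite -pure_tensZl; apply/tens_classE/tens_eq_sym; exact: tens_eq_Z.
Qed.

Lemma pure_tens0l (v : V) : (0 : U) ⊗ v = 0 :> tens U V.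
Proof. by rewrite -(scale0r (0 : U)) pure_tensZl scale0r. Qed.

Lemma pure_tens0r (u : U) : u ⊗ (0 : V) = 0 :> tens U V.
Proof. by rewrite -(scale0r (0 : V)) pure_tensZr scale0r. Qed.

Lemma pure_tens_sumr (A : Type) (r : seq A) (F : A -> V) (u : U) :
  u ⊗ (\sum_(a <- r) F a) = \sum_(a <- r) u ⊗ F a :> tens U V.
Proof.
by apply: (big_morph (fun v => u ⊗ v)) => [v v'|];
  rewrite (pure_tensDr, pure_tens0r).
Qed.

End TensorGeneralities.

Section SpatialForm.
Context {C : numClosedFieldType} {S T : opsys C}.
Implicit Types (x : tens S T) (v : os_hilbert S) (w : os_hilbert T).

(** The form of [x], viewed as an operator on the Hilbert space tensor product,
    between the elementary tensors [v ⊗ w] and [v' ⊗ w']. *)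
Definition tform x v w v' w' : C :=
  tens_lift (W := C^o) (fun s t => sform s v v' * sform t w w') x.

Section Linear.
Variables (v v' : os_hilbert S) (w w' : os_hilbert T).

Lemma tform_linear : GRing.linear_for *%R (fun x => tform x v w v' w').
Proof.
apply: (tens_lift_linear (W := C^o)) => [t a s s'|s a t t'].
  by rewrite sformDl sformZl mulrDl -mulrA.
by rewrite sformDl sformZl mulrDr mulrCA.
Qed.

Lemma tform_pure s t : tform (s ⊗ t) v w v' w' = sform s v v' * sform t w w'.
Proof.
apply: (tens_liftE (W := C^o)) => [t' a s' s''|s' a t' t''].
  by rewrite sformDl sformZl mulrDl -mulrA.
by rewrite sformDl sformZl mulrDr mulrCA.
Qed.

Lemma tformD x y : tform (x + y) v w v' w' = tform x v w v' w' + tform y v w v' w'.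
Proof. by rewrite -{1}[x]scale1r tform_linear mul1r. Qed.

Lemma tform0 : tform 0 v w v' w' = 0.
Proof. by apply: (addrI (tform 0 v w v' w')); rewrite -tformD !addr0. Qed.

Lemma tformZ k x : tform (k *: x) v w v' w' = k * tform x v w v' w'.
Proof. by rewrite -[k *: x]addr0 tform_linear tform0 addr0. Qed.

Lemma tform_sum (A : Type) (r : seq A) (F : A -> tens S T) :
  tform (\sum_(a <- r) F a) v w v' w' = \sum_(a <- r) tform (F a) v w v' w'.
Proof.
by apply: (big_morph (fun x => tform x v w v' w')) => [x y|];
  rewrite (tformD, tform0).
Qed.

End Linear.

(** Positivity of [X] as an operator on [n] copies of the Hilbert space tensor
    product; the vectors are arbitrary finite sums of elementary tensors, the
    summand [i] sitting in the copy [f i]. *)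
Definition spatial_pos n (X : 'M[tens S T]_n) :=
  forall (I : finType) (f : I -> 'I_n) (v : I -> os_hilbert S)
      (w : I -> os_hilbert T),
    0 <= \sum_i \sum_j tform (X (f i) (f j)) (v j) (w j) (v i) (w i).

End SpatialForm.

Section MinCone.
Context {C : numClosedFieldType}.

(** The finitely many vectors involved lie in the span of finite orthonormal
    families, and compressing both factors to these spans is a pair of unital
    completely positive maps into matrix algebras. *)
Lemma min_spatial_pos (S T : opsys C) n (X : 'M[tens S T]_n) :
  @min_cones C S T n X -> spatial_pos X.
Proof.
move=> Xmin I f v w.
have [k [e [c [eo vE]]]] := orthonormal_coordinates v.
have [m [e' [d [eo' wE]]]] := orthonormal_coordinates w.
have := Xmin k m (compress e : {linear _ -> _}) (compress e' : {linear _ -> _})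
  (compress_ucp eo) (compress_ucp eo').
move=> /(_ (fun i => \sum_(a | f a == i) col_tens (c a) (d a))).
congr (0 <= _).
have key x a b : mxform (tens_lift (fun s t => compress e s *t compress e' t) x)
   (col_tens (c b) (d b)) (col_tens (c a) (d a)) = tform x (v b) (w b) (v a) (w a).
  rewrite /tens_lift mxform_sum [in RHS](tens_sum x) tform_sum.
  apply: eq_bigr => p _; rewrite tform_pure mxform_tens.
  by rewrite !mxform_compress !vE !wE.
transitivity (\sum_i \sum_j \sum_(a | f a == i) \sum_(b | f b == j)
    tform (X i j) (v b) (w b) (v a) (w a)).
  apply: eq_bigr => i _; apply: eq_bigr => j _.
  rewrite -[LHS]/(mxform _ _ _) mxE mxform_conj_sum; apply: eq_bigr => a _.
  by rewrite mxform_sumr; apply: eq_bigr => b _; rewrite key.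
rewrite [RHS](partition_big f xpredT) //=; apply: eq_bigr => i _.
rewrite exchange_big /=; apply: eq_bigr => a /eqP <-.
rewrite [RHS](partition_big f xpredT) //=; apply: eq_bigr => j _.
by apply: eq_bigr => b /eqP <-.
Qed.

Definition tens_mapl (S S' T : opsys C) (f : S -> S') (x : tens S T) : tens S' T :=
  tens_lift (fun s t => f s ⊗ t) x.

Section MapLeft.
Variables (S S' T : opsys C) (f : {linear S -> S'}).

Lemma tens_mapl_linear : linear (tens_mapl f : tens S T -> tens S' T).
Proof.
apply: tens_lift_linear => [t a s s'|s a t t'].
  by rewrite linearP pure_tensDl pure_tensZl.
by rewrite pure_tensDr pure_tensZr.
Qed.

HB.instance Definition _ := GRing.isLinear.Build C (tens S T) (tens S' T) _
  (tens_mapl f) tens_mapl_linear.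

Lemma tens_mapl_pure s (t : T) : tens_mapl f (s ⊗ t) = f s ⊗ t.
Proof.
apply: tens_liftE => [t' a s' s''|s' a t' t''].
  by rewrite linearP pure_tensDl pure_tensZl.
by rewrite pure_tensDr pure_tensZr.
Qed.

End MapLeft.

(** The slice of an element of [S ⊗ T] by the vector functional
    [t |-> <t w, w'>] is an element of [S]. *)
Definition slice (S T : opsys C) (x : tens S T) (w w' : os_hilbert T) : S :=
  tens_lift (fun s t => sform t w w' *: s) x.

Lemma sform_slice (S L T : opsys C) (lam : {linear S -> L}) (x : tens S T) v w v' w' :
  sform (lam (slice x w w')) v v' = tform (tens_mapl lam x) v w v' w'.
Proof.
rewrite /slice /tens_mapl /tens_lift linear_sum sform_suml tform_sum.
apply: eq_bigr => p _; rewrite tform_pure linearZ /=.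
by rewrite sformZl mulrC.
Qed.

(** The two maps are applied one after the other. Slicing the right factor by
    vectors of the Hilbert space of [T] gives a matrix over [S], positive
    because its image under [lam] is; so [phi] may be applied. What is left is
    a matrix over [T], whose positivity as an operator has just been tested on
    all vectors; so [psi] may be applied. Since only positivity over [S] is
    pulled back along [lam], the minimal cones of a subsystem come from those
    of the larger system, and [phi] never has to be extended. *)
Lemma spatial_pos_min (S L T : opsys C) (lam : {linear S -> L}) n
    (X : 'M[tens S T]_n) :
  complete_order_embedding lam ->
  spatial_pos (map_mx (tens_mapl lam) X) -> @min_cones C S T n X.
Proof.
move=> lame Xpos k m phi psi [_ phicp] [_ psicp] v.
pose I : finType := ('I_n * 'I_k)%type.
(* the left slot of the vector v is expanded in the standard basis *)
pose dlt (a : I) : 'cV[C]_k := delta_mx a.2 0.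
pose z (a : I) : 'cV[C]_m := \col_r v a.1 (mxtens_index (a.2, r)) 0.
pose Y (a b : I) : T :=
  tens_lift (fun s t => mxform (phi s) (dlt b) (dlt a) *: t) (X a.1 b.1).
have Ypos : pos_fam Y.
  move=> w.
  have slpos : pos_fam (fun a b : I => slice (X a.1 b.1) (w b) (w a)).
    apply: (embedding_pos_fam lame) => x.
    have := Xpos I (fun a => a.1) x w; congr (0 <= _).
    by apply: eq_bigr => a _; apply: eq_bigr => b _; rewrite mxE -sform_slice.
  have := cp_matrix_fam dlt phicp slpos; congr (0 <= _).
  apply: eq_bigr => a _; apply: eq_bigr => b _.
  rewrite /slice /Y /tens_lift linear_sum mxform_sum sform_suml.
  apply: eq_bigr => p _; rewrite linearZ /= sformZl.
  by rewrite /mxform -scalemxAr -scalemxAl mxE mulrC.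
have := cp_matrix_fam z psicp Ypos; congr (0 <= _).
transitivity (\sum_(i < n) \sum_(j < n) \sum_(p < k) \sum_(q < k)
  mxform (psi (Y (i, p) (j, q))) (z (j, q)) (z (i, p))).
  symmetry; under eq_bigr => i _ do rewrite exchange_big /=.
  rewrite pair_bigA /=; apply: eq_bigr => -[i p] _ /=.
  by rewrite pair_bigA /=; apply: eq_bigr => -[j q] _.
apply: eq_bigr => i _; apply: eq_bigr => j _.
rewrite -[RHS]/(mxform _ _ _) mxE.
rewrite [v i]col_tens_decomp [v j]col_tens_decomp mxform_conj_sum.
apply: eq_bigr => p _; rewrite mxform_sumr; apply: eq_bigr => q _.
rewrite /Y /tens_lift linear_sum !mxform_sum; apply: eq_bigr => a _.
rewrite linearZ /= mxform_tens.
by rewrite {1}/mxform -scalemxAr -scalemxAl mxE.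
Qed.

End MinCone.

(** * The Schur product theorem *)
Section SchurProduct.
Context {C : numClosedFieldType}.

Definition psd (I : finType) (M : I -> I -> C) :=
  forall x : I -> C, 0 <= \sum_i \sum_j M i j * x j * (x i)^*.

Lemma sum_support2 (V : nmodType) (I : finType) (G : I -> I -> V) (i j : I) :
  i != j -> (forall a b, ~~ ((a \in [:: i; j]) && (b \in [:: i; j])) -> G a b = 0) ->
  \sum_a \sum_b G a b = G i i + G i j + (G j i + G j j).
Proof.
move=> ij G0; have row a : a \in [:: i; j] -> \sum_b G a b = G a i + G a j.
  move=> aij; rewrite (bigD1 i) //= (bigD1 j) 1?eq_sym //= big1 ?addr0 // => b.
  by case/andP=> bi bj; apply: G0; rewrite !inE (negPf bi) (negPf bj) andbF.
rewrite (bigD1 i) //= [X in _ + X](bigD1 j) 1?eq_sym //=.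
rewrite !row ?inE ?eqxx ?orbT // big1 ?addr0 // => a /andP[ai aj].
by apply: big1 => b _; apply: G0; rewrite !inE (negPf ai) (negPf aj).
Qed.

Lemma psd_herm (I : finType) (M : I -> I -> C) : psd M ->
  forall i j, M j i = (M i j)^*.
Proof.
move=> Mpos.
have re x : \sum_i \sum_j M i j * x j * (x i)^* \is Num.real.
  exact/ger0_real/Mpos.
have diag i : M i i \is Num.real.
  have := re (fun a => (a == i)%:R).
  rewrite (bigD1 i) //= (bigD1 i) //= !eqxx conjC1 !mulr1.
  rewrite big1 => [|b /negPf ->]; last by rewrite mulr0 mul0r.
  rewrite big1 ?addr0 // => a /negPf ai; apply: big1 => b _.
  by rewrite ai conjC0 mulr0.
move=> i j; have [->|ij] := eqVneq i j; first by rewrite conj_Creal.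
(* only the vectors supported on the indices i and j matter *)
have off (k : C) : M i j * k + M j i * k^* \is Num.real.
  pose x a : C := if a == i then 1 else if a == j then k else 0.
  have xi : x i = 1 by rewrite /x eqxx.
  have xj : x j = k by rewrite /x eq_sym (negPf ij) eqxx.
  have := re x; rewrite (sum_support2 ij) => [|a b]; last first.
    rewrite !inE /x negb_and !negb_or => /orP[|] /andP[/negPf-> /negPf->];
      by rewrite ?conjC0 ?mulr0 ?mul0r.
  rewrite xi xj conjC1 !mulr1 -mulrA => h.
  have -> : M i j * k + M j i * k^* =
      (M i i + M i j * k + (M j i * k^* + M j j * (k * k^*))) - M i i - M j j * (k * k^*).
    by ring.
  apply: rpredB; first exact: rpredB h (diag i).
  by apply: rpredM (diag j) _; rewrite -normCK rpredX // normr_real.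
apply: real_polarization; first by have := off 1; rewrite conjC1 !mulr1.
by have := off 'i; rewrite conjCi mulrN ![_ * 'i]mulrC.
Qed.

(** Both [M] and [i M] are then positive semidefinite, hence hermitian. *)
Lemma psd_null (I : finType) (M : I -> I -> C) :
  (forall x : I -> C, \sum_i \sum_j M i j * x j * (x i)^* = 0) ->
  forall i j, M i j = 0.
Proof.
move=> M0 i j; have M1 : psd M by move=> x; rewrite M0.
have M2 : psd (fun i j => 'i * M i j).
  move=> x; suff -> : \sum_i \sum_j 'i * M i j * x j * (x i)^* = 'i * 0 by rewrite mulr0.
  rewrite -[X in _ = 'i * X](M0 x) mulr_sumr; apply: eq_bigr => a _; rewrite mulr_sumr.
  by apply: eq_bigr => b _; rewrite !mulrA.
have h1 := psd_herm M1 j i; have := psd_herm M2 j i.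
rewrite rmorphM /= conjCi -h1 mulNr => /eqP.
by rewrite -addr_eq0 -mulr2n mulrn_eq0 /= mulf_eq0 (negPf (neq0Ci C)) => /eqP.
Qed.

(** Spectral theorem, each eigenvector being scaled by the square root of its
    eigenvalue. *)
Lemma psd_rank_one (I : finType) (M : I -> I -> C) : psd M ->
  exists (y : 'I_#|I| -> I -> C), forall i j, M i j = \sum_r y r i * (y r j)^*.
Proof.
move=> Mpos; pose A : 'M[C]_#|I| := ord_mx M.
have Aherm : A \is hermsymmx.
  apply/is_hermitianmxP; rewrite expr0 scale1r; apply/matrixP => i j.
  by rewrite !mxE -(psd_herm Mpos).
have := hermitian_normalmx Aherm => /orthomx_spectralP.
set P := spectralmx A; set d := spectral_diag A => AE.
have Pu : P \is unitarymx by apply: spectral_unitarymx.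
have PPi : P *m invmx P = 1%:M by rewrite mulmxV // unitarymx_unit.
have iPE : invmx P = map_mx Num.conj (P^T) by apply: invmx_unitary.
have d_ge0 r : 0 <= d 0 r.
  have dE : diag_mx d = P *m A *m invmx P.
    by rewrite AE !mulmxA PPi mul1mx -mulmxA PPi mulmx1.
  have /matrixP /(_ r r) := dE; rewrite mxE eqxx mulr1n => ->.
  have := Mpos (fun i => (P r (enum_rank i))^*); congr (0 <= _).
  rewrite -(sum_enum2 (fun i j => M i j * _ * _)).
  rewrite iPE !mxE exchange_big /=; apply: eq_bigr => j _.
  rewrite !mxE mulr_suml; apply: eq_bigr => i _.
  by rewrite !mxE !enum_valK conjCK mulrC mulrA.
exists (fun r i => sqrtC (d 0 r) * (P r (enum_rank i))^*) => i j.
have -> : M i j = A (enum_rank i) (enum_rank j) by rewrite mxE !enum_rankK.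
rewrite AE iPE mul_mx_diag mxE; apply: eq_bigr => r _.
rewrite !mxE rmorphM /= conjCK [(sqrtC _)^*]conj_Creal; last first.
  by rewrite ger0_real // sqrtC_ge0.
by rewrite mulrACA -expr2 sqrtCK; ring.
Qed.

(** Multiplying entrywise by a rank-one matrix is conjugation by a diagonal
    matrix, which preserves positivity. *)
Lemma psd_schur (I : finType) (M N : I -> I -> C) : psd M -> psd N ->
  psd (fun i j => M i j * N i j).
Proof.
move=> Mpos /psd_rank_one [y Ny] x.
have -> : \sum_i \sum_j M i j * N i j * x j * (x i)^* =
  \sum_r \sum_i \sum_j M i j * (x j * (y r j)^*) * (x i * (y r i)^*)^*.
  rewrite [RHS]exchange_big /=; apply: eq_bigr => i _.
  rewrite [RHS]exchange_big /=; apply: eq_bigr => j _.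
  rewrite Ny mulr_sumr !mulr_suml; apply: eq_bigr => r _.
  by rewrite rmorphM /= conjCK; ring.
by apply: sumr_ge0 => r _; apply: Mpos.
Qed.

End SchurProduct.

(** * The maximal precones *)
Section PositiveFamilies.
Context {C : numClosedFieldType} {S : opsys C}.

(** The vectors indexed by a fibre of [f] may be added up. *)
Lemma pos_fam_pull (I J : finType) (P : I -> I -> S) (f : J -> I) :
  pos_fam P -> pos_fam (fun i j => P (f i) (f j)).
Proof.
move=> Ppos x; have := Ppos (fun i => \sum_(a | f a == i) x a); congr (0 <= _).
transitivity (\sum_i \sum_j \sum_(a | f a == i) \sum_(b | f b == j)
    sform (P i j) (x b) (x a)).
  apply: eq_bigr => i _; apply: eq_bigr => j _.
  rewrite sform_conj_sum; apply: eq_bigr => a _.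
  by rewrite sform_sumr.
rewrite /qform [RHS](partition_big f xpredT) //=; apply: eq_bigr => i _.
rewrite exchange_big /=; apply: eq_bigr => a /eqP <-.
rewrite [RHS](partition_big f xpredT) //=; apply: eq_bigr => j _.
by apply: eq_bigr => b /eqP <-.
Qed.

Lemma pos_fam_psd (I : finType) (P : I -> I -> S) (v : I -> os_hilbert S) :
  pos_fam P -> psd (fun i j => sform (P i j) (v j) (v i)).
Proof.
move=> Ppos x; have := Ppos (fun i => x i *: v i); congr (0 <= _).
apply: eq_bigr => i _; apply: eq_bigr => j _.
by rewrite sform_conjZ sformZr; ring.
Qed.

Definition direct_sum (I J : Type) (P : I -> I -> S) (Q : J -> J -> S)
    (a b : I + J) : S :=
  match a, b with
  | inl i, inl j => P i j
  | inr i, inr j => Q i j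
  | _, _ => 0
  end.

Lemma pos_fam_sum (I J : finType) (P : I -> I -> S) (Q : J -> J -> S) :
  pos_fam P -> pos_fam Q -> pos_fam (direct_sum P Q).
Proof.
move=> Ppos Qpos x.
have := addr_ge0 (Ppos (x \o inl)) (Qpos (x \o inr)); congr (0 <= _).
rewrite [RHS]big_sumType /=; congr (_ + _); apply: eq_bigr => i _.
  rewrite big_sumType /= [X in _ + X]big1 ?addr0 // => j _.
  by rewrite sform0l.
rewrite big_sumType /= [X in X + _]big1 ?add0r // => j _.
by rewrite sform0l.
Qed.

End PositiveFamilies.

Section MaxCone.
Context {C : numClosedFieldType}.

(** The generators [a (P ⊗ Q) a^*] of the maximal cones, with the Kronecker
    product replaced by the entrywise one. Both forms describe the same cones,
    and this one is stable under sums by a plain disjoint union of index sets. *)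
Definition schur_compression (S T : opsys C) n (K : finType) (a : 'I_n -> K -> C)
    (P : K -> K -> S) (Q : K -> K -> T) : 'M[tens S T]_n :=
  \matrix_(i, j) \sum_s \sum_t (a i s * (a j t)^*) *: (P s t ⊗ Q s t).

Lemma sum_mxtens_diag (V : nmodType) k (F : 'I_k -> V) :
  \sum_(s < k * k) (if (mxtens_unindex s).1 == (mxtens_unindex s).2
                    then F (mxtens_unindex s).1 else 0) = \sum_p F p.
Proof.
transitivity (\sum_(p : 'I_k * 'I_k) if p.1 == p.2 then F p.1 else 0).
  rewrite [RHS](reindex (@mxtens_unindex k k)) //=.
  by exists (@mxtens_index k k) => ? _; rewrite (mxtens_indexK, mxtens_unindexK).
rewrite -(pair_bigA _ (fun i j => if i == j then F i else 0)) /=.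
apply: eq_bigr => p _; rewrite (bigD1 p) //= eqxx big1 ?addr0 // => q /negPf.
by rewrite eq_sym => ->.
Qed.

(** A Kronecker product is the entrywise product of two pulled-back families.
    Conversely, an entrywise product is the block of the Kronecker product
    sitting on the diagonal pairs of indices. *)
Lemma max_preconesP (S T : opsys C) n (X : 'M[tens S T]_n) :
  @max_precones C S T n X <->
  exists (K : finType) (a : 'I_n -> K -> C) (P : K -> K -> S) (Q : K -> K -> T),
    [/\ pos_fam P, pos_fam Q & X = schur_compression a P Q].
Proof.
split=> [[k [m [P [Q [a [/pos_fam_mx Ppos /pos_fam_mx Qpos ->]]]]]]|].
  exists 'I_(k * m), (fun i s => a i s),
    (fun s t => P (mxtens_unindex s).1 (mxtens_unindex t).1),
    (fun s t => Q (mxtens_unindex s).2 (mxtens_unindex t).2); split.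
  - exact: (pos_fam_pull (fun s : 'I_(k * m) => (mxtens_unindex s).1) Ppos).
  - exact: (pos_fam_pull (fun s : 'I_(k * m) => (mxtens_unindex s).2) Qpos).
  - apply/matrixP => i j; rewrite !mxE; apply: eq_bigr => s _.
    by apply: eq_bigr => t _; rewrite mxE.
move=> [K [a [P [Q [/pos_fam_ord_mx Ppos /pos_fam_ord_mx Qpos ->]]]]].
exists #|K|, #|K|, (ord_mx P), (ord_mx Q), (\matrix_(i, s)
  if (mxtens_unindex s).1 == (mxtens_unindex s).2
  then a i (enum_val (mxtens_unindex s).1) else 0); split=> //.
apply/matrixP => i j; rewrite !mxE.
rewrite -(sum_enum2 (fun s t => (a i s * (a j t)^*) *: (P s t ⊗ Q s t))).
rewrite -sum_mxtens_diag; apply: eq_bigr => s _.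
have [es|ns] := eqVneq; last first.
  by rewrite big1 // => t _; rewrite !mxE (negPf ns) mul0r scale0r.
rewrite -sum_mxtens_diag; apply: eq_bigr => t _.
rewrite !mxE -es eqxx; have [<- //|_] := eqVneq.
by rewrite conjC0 mulr0 scale0r.
Qed.

Lemma max_precones_add (S T : opsys C) n (X Y : 'M[tens S T]_n) :
  @max_precones C S T n X -> @max_precones C S T n Y -> @max_precones C S T n (X + Y).
Proof.
move=> /max_preconesP[K [a [P [Q [Ppos Qpos ->]]]]].
move=> /max_preconesP[K' [a' [P' [Q' [Ppos' Qpos' ->]]]]].
apply/max_preconesP.
exists (K + K')%type, (fun i s => match s with inl s => a i s | inr s => a' i s end).
exists (direct_sum P P'), (direct_sum Q Q').
split; [exact: pos_fam_sum Ppos Ppos' | exact: pos_fam_sum Qpos Qpos' |].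
apply/matrixP => i j; rewrite !mxE [RHS]big_sumType /=.
congr (_ + _); apply: eq_bigr => s _.
  rewrite big_sumType /= [X in _ + X]big1 ?addr0 // => t _.
  by rewrite pure_tens0l scaler0.
rewrite big_sumType /= [X in X + _]big1 ?add0r // => t _.
by rewrite pure_tens0l scaler0.
Qed.

Lemma max_precones_pure (S T : opsys C) n (A : 'M[S]_n) (t : T) :
  mo_pos A -> pos_fam (fun _ _ : 'I_1 => t) ->
  @max_precones C S T n (\matrix_(i, j) (A i j ⊗ t)).
Proof.
move=> Apos tpos; apply/max_preconesP.
exists 'I_n, (fun i s => (i == s)%:R), (fun i j => A i j), (fun _ _ => t); split=> //.
  exact: (pos_fam_pull (fun _ : 'I_n => ord0) tpos).
apply/matrixP => i j; rewrite !mxE (bigD1 i) //= (bigD1 j) //= !eqxx conjC1 mulr1 scale1r.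
rewrite !big1 ?addr0 // => [s /negPf si|s /negPf sj].
  by rewrite big1 // => r _; rewrite eq_sym si mul0r scale0r.
by rewrite eq_sym sj conjC0 mulr0 scale0r.
Qed.

Lemma max_precones_mapl (S L T : opsys C) (lam : {linear S -> L}) n (X : 'M[tens S T]_n) :
  completely_positive lam ->
  @max_precones C S T n X -> @max_precones C L T n (map_mx (tens_mapl lam) X).
Proof.
move=> lamcp /max_preconesP[K [a [P [Q [Ppos Qpos ->]]]]]; apply/max_preconesP.
exists K, a, (fun s t => lam (P s t)), Q; split=> //.
  exact: cp_pos_fam lamcp Ppos.
apply/matrixP => i j; rewrite !mxE linear_sum; apply: eq_bigr => s _.
rewrite linear_sum; apply: eq_bigr => t _.
by rewrite linearZ /= tens_mapl_pure.
Qed.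

(** Tested on vectors, the two factors become scalar positive semidefinite
    matrices, and their entrywise product is positive by Schur. *)
Lemma max_precones_spatial_pos (S T : opsys C) n (X : 'M[tens S T]_n) :
  @max_precones C S T n X -> spatial_pos X.
Proof.
move=> /max_preconesP[K [a [P [Q [Ppos Qpos ->]]]]] I f v w.
pose N : finType := (I * K)%type.
have M1 := pos_fam_psd (fun b : N => v b.1) (pos_fam_pull (fun b : N => b.2) Ppos).
have M2 := pos_fam_psd (fun b : N => w b.1) (pos_fam_pull (fun b : N => b.2) Qpos).
have := psd_schur M1 M2 (fun b => (a (f b.1) b.2)^*); congr (0 <= _).
transitivity (\sum_i \sum_s \sum_j \sum_t sform (P s t) (v j) (v i)
    * sform (Q s t) (w j) (w i) * (a (f j) t)^* * ((a (f i) s)^*)^*).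
  symmetry; rewrite pair_bigA /=; apply: eq_bigr => -[i s] _ /=.
  by rewrite pair_bigA; apply: eq_bigr => -[j t] _.
apply: eq_bigr => i _; rewrite exchange_big /=; apply: eq_bigr => j _.
rewrite mxE tform_sum; apply: eq_bigr => s _.
rewrite tform_sum; apply: eq_bigr => t _.
by rewrite tformZ tform_pure conjCK; ring.
Qed.

End MaxCone.

(** * Hermitian representatives of positive tensors *)
Section Faithful.
Context {C : numClosedFieldType} {S T : opsys C}.

(** The form separates the points of the algebraic tensor product. If
    [a ⊗ b] is the first term of a representing list and [a] is not zero, some
    value of the form of [a] is invertible; the vanishing of the total form
    then expresses [b] through the right factors of the other terms, which
    yields a shorter list. *)
Lemma tens_faithful (x : tens S T) :
  (forall v w v' w', tform x v w v' w' = 0) -> x = 0.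
Proof.
rewrite [x]tens_sum; move: (repr x) => l {x}.
have [m] := ubnP (size l); elim: m l => // m IHm [|[a b] l] /=.
  by rewrite big_nil.
rewrite ltnS big_cons /= => lm x0.
have [a0|aN0] := pselect (forall v v', sform a v v' = 0).
  move: x0; rewrite (sform_sep a0) pure_tens0l add0r; exact: IHm.
have [v0 [v0' c0]] : exists v v', sform a v v' != 0.
  apply: contra_notP aN0 => h v v'; apply/eqP; apply: contra_notT h => h.
  by exists v, v'.
pose c := sform a v0 v0'; pose k (p : S * T) := - (c^-1 * sform p.1 v0 v0').
have bE : b = \sum_(p <- l) k p *: p.2.
  apply/eqP; rewrite -subr_eq0; apply/eqP/sform_sep => w w'.
  rewrite sformBl sform_suml; have := x0 v0 w v0' w'.
  rewrite tformD tform_sum tform_pure -/c => h.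
  apply: (mulfI c0); rewrite mulr0 -[RHS]h mulrBr; congr (_ + _).
  rewrite -mulrN -sumrN mulr_sumr; apply: eq_bigr => p _.
  by rewrite tform_pure sformZl /k mulNr opprK -mulrA mulVKf.
have lE : a ⊗ b + \sum_(p <- l) p.1 ⊗ p.2
    = \sum_(p <- [seq (k p *: a + p.1, p.2) | p <- l]) p.1 ⊗ p.2.
  rewrite bE pure_tens_sumr big_map -big_split; apply: eq_bigr => p _ /=.
  by rewrite pure_tensDl pure_tensZl pure_tensZr.
by rewrite lE; apply: IHm; rewrite ?size_map // -lE.
Qed.

End Faithful.

Section Hermitian.
Context {C : numClosedFieldType}.

Section OneSystem.
Variables (S : opsys C) (I : finType).
Implicit Types P Q : I -> I -> S.

(** Being hermitian, said entry by entry and without naming an adjoint. *)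
Definition herm_fam P :=
  forall i j x y, sform (P j i) y x = (sform (P i j) x y)^*.

(** Real and imaginary parts; this is where self-adjointness of the operator
    system enters. *)
Lemma cartesian_fam P : exists A B,
  [/\ herm_fam A, herm_fam B & forall i j, P i j = A i j + 'i *: B i j].
Proof.
have [adj adjE] := choice (fun s : S => sform_adjoint s).
exists (fun i j => 2^-1 *: (P i j + adj (P j i))).
exists (fun i j => (- 'i / 2) *: (P i j - adj (P j i))); split.
- move=> i j x y; rewrite !sformZl !sformDl !adjE.
  by rewrite rmorphM rmorphD /= conjCK fmorphV /= conjC_nat addrC.
- move=> i j x y; rewrite !sformZl !sformBl !adjE.
  rewrite !rmorphM rmorphB rmorphN /= conjCK conjCi fmorphV /= conjC_nat.
  by rewrite opprK; ring.
- move=> i j; rewrite scalerA mulrA mulrN -expr2 sqrCi opprK mul1r -scalerDr.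
  rewrite addrACA subrr addr0 -mulr2n -scalerMnr scalerMnl.
  by rewrite -[_ *+ _]mulr_natr mulVf ?scale1r ?pnatr_eq0.
Qed.

Lemma qformD P Q x : qform (fun i j => P i j + Q i j) x = qform P x + qform Q x.
Proof.
rewrite -big_split; apply: eq_bigr => i _; rewrite -big_split.
by apply: eq_bigr => j _; rewrite sformDl.
Qed.

Lemma qformZ k P x : qform (fun i j => k *: P i j) x = k * qform P x.
Proof.
rewrite mulr_sumr; apply: eq_bigr => i _; rewrite mulr_sumr.
by apply: eq_bigr => j _; rewrite sformZl.
Qed.

Lemma sum_herm_real (M : I -> I -> C) : (forall i j, M j i = (M i j)^*) ->
  \sum_i \sum_j M i j \is Num.real.
Proof.
move=> Mh; apply/CrealP; rewrite rmorph_sum [RHS]exchange_big /=.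
apply: eq_bigr => i _; rewrite rmorph_sum; apply: eq_bigr => j _.
exact/esym/Mh.
Qed.

Lemma herm_qform_real P x : herm_fam P -> qform P x \is Num.real.
Proof. by move=> Ph; apply: sum_herm_real => i j; apply: Ph. Qed.

Definition nrm2 (x : I -> os_hilbert S) : C := \sum_i `|x i| ^+ 2.

Lemma nrm2_ge0 x : 0 <= nrm2 x.
Proof. by apply: sumr_ge0 => i _; rewrite exprn_ge0. Qed.

Definition unit_fam (i j : I) : S := if i == j then mo_unit S else 0.

Lemma qform_unit x : qform unit_fam x = nrm2 x.
Proof.
apply: eq_bigr => i _; rewrite (bigD1 i) //= /unit_fam eqxx sform1 inner_norm.
rewrite big1 ?addr0 // => j /negPf; rewrite eq_sym => ->.
by rewrite sform0l.
Qed.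

Lemma qform_bound P (c : I -> I -> C) x : (forall i j, 0 <= c i j) ->
  (forall i j v w, `|sform (P i j) v w| <= c i j * (`|v| ^+ 2 + `|w| ^+ 2)) ->
  `|qform P x| <= (\sum_i \sum_j c i j) *+ 2 * nrm2 x.
Proof.
move=> c0 Pc; apply: le_trans (ler_norm_sum _ _ _) _.
rewrite mulrnAl -mulrnAr mulr_suml; apply: ler_sum => i _.
apply: le_trans (ler_norm_sum _ _ _) _.
rewrite mulr_suml; apply: ler_sum => j _.
apply: le_trans (Pc _ _ _ _) _; apply: ler_wpM2l => //.
have le1 k : `|x k| ^+ 2 <= nrm2 x.
  by rewrite /nrm2 (bigD1 k) //= lerDl sumr_ge0 // => l _; rewrite exprn_ge0.
by rewrite mulr2n lerD.
Qed.

Lemma qform_bounded P : exists2 c, 0 < c & forall x, `|qform P x| <= c * nrm2 x.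
Proof.
have /choice [c cP] (p : I * I) : exists d : C, 0 <= d /\ forall v w,
    `|sform (P p.1 p.2) v w| <= d * (`|v| ^+ 2 + `|w| ^+ 2).
  by have [d d0 Pd] := sform_bounded (P p.1 p.2); exists d.
have c0 i j : 0 <= c (i, j) by case: (cP (i, j)).
exists ((\sum_i \sum_j c (i, j)) *+ 2 + 1) => [|x].
  by rewrite ltr_wpDl // mulrn_wge0 // sumr_ge0 // => i _; rewrite sumr_ge0.
rewrite mulrDl mul1r; apply: ler_wpDr; first exact: nrm2_ge0.
by apply: (@qform_bound _ (fun i j => c (i, j))) => // i j; case: (cP (i, j)).
Qed.

Lemma real_small_pos (P : I -> I -> S) d :
  (forall x, qform P x \is Num.real) -> (forall x, `|qform P x| <= d * nrm2 x) ->
  pos_fam (fun i j => d *: unit_fam i j + P i j).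
Proof.
move=> Pr Pd x; rewrite qformD qformZ qform_unit addrC -lerBlDr sub0r.
by have := Pd x; rewrite real_ler_norml // => /andP[].
Qed.

End OneSystem.

(** A hermitian family becomes positive after adding a multiple of the unit,
    and a unital map moves that multiple along. *)
Lemma cp_herm (S T : opsys C) (I : finType) (f : {linear S -> T}) (P : I -> I -> S) :
  ucp f -> herm_fam P -> forall x, qform (fun i j => f (P i j)) x \is Num.real.
Proof.
move=> [f1 fcp] Ph x; have [c c0 Pc] := qform_bounded P.
have := real_small_pos (fun x => herm_qform_real x Ph) Pc.
move=> /(cp_pos_fam fcp) /(_ x) /ger0_real.
have -> : qform (fun i j => f (c *: unit_fam S i j + P i j)) x
  = c * nrm2 x + qform (fun i j => f (P i j)) x.
  rewrite -qform_unit -qformZ -qformD; apply: eq_bigr => i _; apply: eq_bigr => j _.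
  congr (sform _ _ _); rewrite linearD linearZ /unit_fam.
  by case: eqP => _ /=; [rewrite f1 | rewrite linear0].
move=> h; rewrite -(addKr (c * nrm2 x) (qform _ _)) addrC.
apply: rpredB => //; apply: rpredM; last exact/ger0_real/nrm2_ge0.
exact/gtr0_real.
Qed.

End Hermitian.

Section HermitianTensors.
Context {C : numClosedFieldType} {S T : opsys C}.

Definition tens_mx n (A : 'M[S]_n) (t : T) : 'M[tens S T]_n :=
  \matrix_(i, j) (A i j ⊗ t).

Definition herm_pair n (p : 'M[S]_n * T) :=
  herm_fam (fun i j => p.1 i j) /\ herm_fam (fun _ _ : 'I_1 => p.2).

Definition herm_tensor n (X : 'M[tens S T]_n) :=
  exists l : seq ('M[S]_n * T),
    (forall p, p \in l -> herm_pair p) /\ X = \sum_(p <- l) tens_mx p.1 p.2.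

(** Entrywise products of hermitian matrices are hermitian. *)
Lemma herm_tensor_real n (X : 'M[tens S T]_n) : herm_tensor X ->
  forall (I : finType) (f : I -> 'I_n) v w,
  \sum_i \sum_j tform (X (f i) (f j)) (v j) (w j) (v i) (w i) \is Num.real.
Proof.
move=> [l [lh ->]] I f v w.
have -> : \sum_i \sum_j tform ((\sum_(p <- l) tens_mx p.1 p.2) (f i) (f j))
      (v j) (w j) (v i) (w i)
  = \sum_(p <- l) \sum_i \sum_j
      sform (p.1 (f i) (f j)) (v j) (v i) * sform p.2 (w j) (w i).
  rewrite [RHS]exchange_big; apply: eq_bigr => i _.
  rewrite [RHS]exchange_big; apply: eq_bigr => j _.
  rewrite summxE tform_sum; apply: eq_bigr => p _.
  by rewrite mxE tform_pure.
rewrite big_seq; apply: rpred_sum => p /lh[h1 h2].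
apply: sum_herm_real => i j; rewrite rmorphM /=.
by rewrite -(h1 (f i) (f j)) -(h2 ord0 ord0).
Qed.

Lemma herm_tensorD n (X Y : 'M[tens S T]_n) :
  herm_tensor X -> herm_tensor Y -> herm_tensor (X + Y).
Proof.
move=> [l [lh ->]] [l' [lh' ->]]; exists (l ++ l'); split; last by rewrite big_cat.
by move=> p; rewrite mem_cat => /orP[/lh|/lh'].
Qed.

Lemma herm_tensorN n (X : 'M[tens S T]_n) : herm_tensor X -> herm_tensor (- X).
Proof.
move=> [l [lh ->]]; exists [seq (p.1, - p.2) | p <- l]; split.
  move=> _ /mapP[p /lh[h1 h2] ->]; split=> // i j x y.
  by rewrite !sformNl h2 // rmorphN.
rewrite big_map -sumrN; apply: eq_bigr => p _; apply/matrixP => i j.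
by rewrite !mxE -scaleN1r pure_tensZr scaleN1r.
Qed.

Lemma herm_tensor_cartesian n (X : 'M[tens S T]_n) :
  exists Y Z : 'M[tens S T]_n, [/\ herm_tensor Y, herm_tensor Z &
    forall i j, X i j = Y i j + 'i *: Z i j].
Proof.
pose good (X : 'M[tens S T]_n) :=
  exists Y Z : 'M[tens S T]_n, [/\ herm_tensor Y, herm_tensor Z &
    forall i j, X i j = Y i j + 'i *: Z i j].
have good0 : good 0.
  have h0 : herm_tensor (0 : 'M[tens S T]_n) by exists [::]; rewrite big_nil.
  by exists 0, 0; split=> // i j; rewrite !mxE scaler0 addr0.
have goodD X1 X2 : good X1 -> good X2 -> good (X1 + X2).
  move=> [Y [Z [hY hZ XE1]]] [Y' [Z' [hY' hZ' XE2]]].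
  exists (Y + Y'), (Z + Z'); split; [exact: herm_tensorD|exact: herm_tensorD|].
  by move=> i j; rewrite !mxE XE1 XE2 scalerDr addrACA.
have good_sum (A : Type) (r : seq A) F :
    (forall a, good (F a)) -> good (\sum_(a <- r) F a).
  by move=> gF; apply: big_ind.
have good_pure (B : 'M[S]_n) t : good (tens_mx B t).
  have [A0 [B0 [Ah Bh BE]]] := cartesian_fam (fun i j => B i j).
  have [h0 [k0 [hh kh tE]]] := cartesian_fam (fun _ _ : 'I_1 => t).
  pose A := \matrix_(i, j) A0 i j; pose D := \matrix_(i, j) B0 i j.
  pose h := h0 ord0 ord0; pose k := k0 ord0 ord0.
  have Ahm : herm_fam (fun i j => A i j) by move=> i j x y; rewrite !mxE; apply: Ah.
  have Dhm : herm_fam (fun i j => D i j) by move=> i j x y; rewrite !mxE; apply: Bh.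
  have hhm : herm_fam (fun _ _ : 'I_1 => h) by move=> i j x y; apply: hh.
  have khm : herm_fam (fun _ _ : 'I_1 => k) by move=> i j x y; apply: kh.
  have hp (E : 'M[S]_n) (s : T) : herm_fam (fun i j => E i j) ->
      herm_fam (fun _ _ : 'I_1 => s) -> herm_tensor (tens_mx E s).
    move=> Eh sh; exists [:: (E, s)]; split; last by rewrite big_seq1.
    by move=> p; rewrite inE => /eqP ->.
  exists (tens_mx A h - tens_mx D k), (tens_mx D h + tens_mx A k); split.
  - by apply: herm_tensorD; [|apply: herm_tensorN]; apply: hp.
  - by apply: herm_tensorD; apply: hp.
  - move=> i j; rewrite !mxE BE (tE ord0 ord0) -/h -/k.
    rewrite pure_tensDl !pure_tensDr !pure_tensZl !pure_tensZr scalerA -expr2 sqrCi.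
    by rewrite scaleN1r scalerDr addrACA [RHS]addrAC !addrA addrAC; congr (_ + _);
      rewrite addrAC.
have -> : X = \sum_i \sum_j \sum_(p <- repr (X i j))
    tens_mx (\matrix_(a, b) if (a == i) && (b == j) then p.1 else 0) p.2.
  apply/matrixP => a b; rewrite summxE (bigD1 a) //= [X in _ + X]big1.
    rewrite addr0 summxE (bigD1 b) //= [X in _ + X]big1.
      rewrite addr0 summxE {1}[X a b]tens_sum; apply: eq_bigr => p _.
      by rewrite !mxE !eqxx.
    move=> j /negPf jb; rewrite summxE; apply: big1 => p _.
    by rewrite !mxE eqxx eq_sym jb pure_tens0l.
  move=> i /negPf ia; rewrite summxE; apply: big1 => j _; rewrite summxE.
  by apply: big1 => p _; rewrite !mxE eq_sym ia pure_tens0l.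
by do 3![apply: (good_sum) => ?]; apply: good_pure.
Qed.

(** Write [X = Y + i Z] with [Y] and [Z] hermitian. A positive form is real,
    so the quadratic form of [Z] vanishes; by polarization the whole form of
    [Z] does, and then [Z = 0]. *)
Lemma spatial_pos_herm n (X : 'M[tens S T]_n) : spatial_pos X -> herm_tensor X.
Proof.
move=> Xpos; have [Y [Z [Yh Zh XE]]] := herm_tensor_cartesian X.
suff Z0 : Z = 0.
  suff -> : X = Y by [].
  by apply/matrixP => i j; rewrite XE Z0 mxE scaler0 addr0.
have Znull (I : finType) (f : I -> 'I_n) v w :
    \sum_i \sum_j tform (Z (f i) (f j)) (v j) (w j) (v i) (w i) = 0.
  have := Xpos I f v w.
  have -> : \sum_i \sum_j tform (X (f i) (f j)) (v j) (w j) (v i) (w i)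
    = \sum_i \sum_j tform (Y (f i) (f j)) (v j) (w j) (v i) (w i)
      + 'i * \sum_i \sum_j tform (Z (f i) (f j)) (v j) (w j) (v i) (w i).
    rewrite mulr_sumr -big_split; apply: eq_bigr => i _ /=.
    rewrite mulr_sumr -big_split; apply: eq_bigr => j _ /=.
    by rewrite XE tformD tformZ.
  move=> /ger0_real /Creal_ImP; rewrite Im_rect ?herm_tensor_real //.
apply/matrixP => i j; rewrite mxE; apply: tens_faithful => v w v' w'.
pose f (b : bool) := if b then i else j.
pose vv b := if b then v' else v; pose ww b := if b then w' else w.
have := @psd_null C bool
  (fun a b => tform (Z (f a) (f b)) (vv b) (ww b) (vv a) (ww a)) _ true false.
apply=> x; rewrite -[RHS](Znull bool f (fun b => x b *: vv b) ww).
apply: eq_bigr => a _; apply: eq_bigr => b _.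
rewrite (tens_sum (Z _ _)) !tform_sum !mulr_suml; apply: eq_bigr => p _.
by rewrite !tform_pure sformZr sform_conjZ; ring.
Qed.

End HermitianTensors.

(** * Perturbation in the maximal precones *)
Section PreconePerturbation.
Context {C : numClosedFieldType} {S T : opsys C}.

Local Notation unit2 := (mo_unit S ⊗ mo_unit T).

Lemma pos_fam_unit (U : opsys C) (I : finType) (c : C) : 0 <= c ->
  pos_fam (fun i j : I => c *: unit_fam U i j).
Proof. by move=> c0 x; rewrite qformZ qform_unit mulr_ge0 // nrm2_ge0. Qed.

Lemma pos_diag_cst (U : opsys C) n (c : C) : 0 <= c ->
  mo_pos (diag_cst n (c *: mo_unit U)).
Proof.
move=> c0; apply/pos_fam_mx => x; have := pos_fam_unit c0 x; congr (0 <= _).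
apply: eq_bigr => i _; apply: eq_bigr => j _; rewrite mxE /unit_fam.
by case: eqP => // _; rewrite scaler0.
Qed.

Lemma pos_scalar_unit (U : opsys C) (c : C) : 0 <= c ->
  pos_fam (fun _ _ : 'I_1 => c *: mo_unit U).
Proof.
move=> c0 x; have := pos_fam_unit c0 x; congr (0 <= _).
apply: eq_bigr => i _; apply: eq_bigr => j _.
by rewrite /unit_fam !ord1 eqxx.
Qed.

Lemma max_precones_unit n (e : C) : 0 <= e ->
  @max_precones C S T n (diag_cst n (e *: unit2)).
Proof.
move=> e0.
have := max_precones_pure (@pos_diag_cst S n _ e0) (@pos_scalar_unit T _ ler01).
congr (max_precones _); apply/matrixP => i j; rewrite !mxE scale1r.
by case: eqP => _; rewrite ?pure_tens0l ?pure_tensZl.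
Qed.

(** A small hermitian left factor is absorbed by the unit, because
    [Z ⊗ t + 3 c d = (d + Z) ⊗ (c + t) + (d - Z) ⊗ c + d ⊗ (c - t)],
    a sum of elementary tensors of positive elements. *)
Lemma max_precones_small n (Z : 'M[S]_n) (t : T) (c d : C) : 0 < c -> 0 < d ->
  pos_fam (fun i j => d *: unit_fam S i j + Z i j) ->
  pos_fam (fun i j => d *: unit_fam S i j - Z i j) ->
  pos_fam (fun _ _ : 'I_1 => c *: mo_unit T + t) ->
  pos_fam (fun _ _ : 'I_1 => c *: mo_unit T - t) ->
  @max_precones C S T n (tens_mx Z t + diag_cst n ((d * c *+ 3) *: unit2)).
Proof.
move=> c0 d0 Zp Zn tp tn.
pose D := diag_cst n (d *: mo_unit S); pose c1 := c *: mo_unit T.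
have DE i j : D i j = d *: unit_fam S i j.
  by rewrite mxE /unit_fam; case: eqP => // _; rewrite scaler0.
have DZp : mo_pos (D + Z).
  apply/pos_fam_mx => x; have := Zp x; congr (0 <= _).
  by apply: eq_bigr => i _; apply: eq_bigr => j _; rewrite mxE DE.
have DZn : mo_pos (D - Z).
  apply/pos_fam_mx => x; have := Zn x; congr (0 <= _).
  by apply: eq_bigr => i _; apply: eq_bigr => j _; rewrite !mxE -DE mxE.
have h1 := max_precones_pure DZp tp.
have h2 := max_precones_pure DZn (@pos_scalar_unit T _ (ltW c0)).
have h3 := max_precones_pure (@pos_diag_cst S n _ (ltW d0)) tn.
have := max_precones_add (max_precones_add h1 h2) h3; congr (max_precones _).
apply/matrixP => i j.
transitivity ((D + Z) i j ⊗ (c1 + t) + (D - Z) i j ⊗ c1 + D i j ⊗ (c1 - t)).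
  by rewrite !mxE.
have -> : (tens_mx Z t + diag_cst n ((d * c *+ 3) *: unit2)) i j
    = Z i j ⊗ t + (D i j ⊗ c1) *+ 3.
  rewrite !mxE; congr (_ + _); case: eqP => _; last by rewrite pure_tens0l mul0rn.
  by rewrite pure_tensZl pure_tensZr scalerA [RHS]scalerMnl.
have -> : (D + Z) i j = D i j + Z i j by rewrite mxE.
have -> : (D - Z) i j = D i j - Z i j by rewrite !mxE.
have NE (s : S) (r : T) : (- s) ⊗ r = - (s ⊗ r) :> tens S T.
  by rewrite -scaleN1r pure_tensZl scaleN1r.
have NEr (s : S) (r : T) : s ⊗ (- r) = - (s ⊗ r) :> tens S T.
  by rewrite -scaleN1r pure_tensZr scaleN1r.
rewrite !pure_tensDl !pure_tensDr NE NEr.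
set p := D i j ⊗ c1; set q := D i j ⊗ t; set r := Z i j ⊗ c1; set s := Z i j ⊗ t.
(* the terms q and r cancel, p occurs three times *)
rewrite (AC (2*2*2*2) ((4*1*5*7)*(2*8)*(3*6))) /=.
by rewrite !subrr !addr0 !mulrS mulr0n addr0 !addrA.
Qed.

End PreconePerturbation.

(** * Approximation in an inductive limit *)
Section Limit.
Context {C : numClosedFieldType}.
Context (S : nat -> opsys C) (u : forall n, {linear S n -> S n.+1}).
Context (L : opsys C) (lam : forall n, {linear S n -> L}).
Context (lim : inductive_limit u lam).

Lemma lam_ucp N : ucp (lam N).
Proof.
split; first exact: lim_unital lim N.
by move=> n X Xpos; have [_ h] := lim_embedding lim N; apply/h.
Qed.

(** The ranges of the embeddings increase, so finitely many approximants can
    be taken at a single stage. *)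
Lemma lift_elt N M (s : S N) : (N <= M)%N -> exists s' : S M, lam M s' = lam N s.
Proof.
move=> /subnKC <-; elim: (M - N)%N => [|k [s' <-]].
  by rewrite addn0; exists s.
by rewrite addnS; exists (u (N + k) s'); rewrite -(lim_compat lim).
Qed.

Lemma tens_mapl_lim N (T : opsys C) (x : tens (S N) T) :
  tens_mapl (lam N.+1) (tens_mapl (u N) x) = tens_mapl (lam N) x.
Proof.
rewrite [x]tens_sum; elim: (repr x) => [|p l IHl]; first by rewrite big_nil !linear0.
by rewrite big_cons !linearD /= IHl !tens_mapl_pure -(lim_compat lim).
Qed.

Lemma lift_tens N M (T : opsys C) n (X : 'M[tens (S N) T]_n) : (N <= M)%N ->
  exists X' : 'M[tens (S M) T]_n,
    map_mx (tens_mapl (lam M)) X' = map_mx (tens_mapl (lam N)) X.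
Proof.
move=> /subnKC <-; elim: (M - N)%N => [|k [X' <-]].
  by rewrite addn0; exists X.
rewrite addnS; exists (map_mx (tens_mapl (u (N + k))) X').
by apply/matrixP => i j; rewrite !mxE tens_mapl_lim.
Qed.

Lemma dense_elt (a : L) (d : C) : 0 < d ->
  exists N (s : S N), opnorm_le (os_op (a - lam N s)) d.
Proof.
move=> d0; have aL : [set a | a \in os_space L]%classic (val a) by exact: valP.
rewrite (lim_dense lim) in aL; have [b [N _ [s _ <-]] h] := aL d d0.
by exists N, s.
Qed.

Lemma dense_mx n (A : 'M[L]_n) (d : C) : 0 < d ->
  exists N (B : 'M[S N]_n), forall i j, opnorm_le (os_op (A i j - lam N (B i j))) d.
Proof.
move=> d0.
have /choice[N Nd] (p : 'I_n * 'I_n) := dense_elt (A p.1 p.2) d0.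
pose M := \max_p N p.
have /choice[B Bd] (p : 'I_n * 'I_n) :
    exists s : S M, opnorm_le (os_op (A p.1 p.2 - lam M s)) d.
  have [s sd] := Nd p; have [s' ss'] := @lift_elt (N p) M s (leq_bigmax p).
  by exists s'; rewrite ss'.
exists M, (\matrix_(i, j) B (i, j)) => i j; rewrite mxE; exact: (Bd (i, j)).
Qed.

(** Approximate the entries, then keep the real part of the approximant: as
    [A] is hermitian, the form of the new error is the real part of the form
    of the old one. *)
Lemma dense_herm_mx n (A : 'M[L]_n) (d : C) : 0 < d ->
  herm_fam (fun i j => A i j) ->
  exists N (B : 'M[S N]_n),
    pos_fam (fun i j => d *: unit_fam L i j + (A - map_mx (lam N) B) i j) /\
    pos_fam (fun i j => d *: unit_fam L i j - (A - map_mx (lam N) B) i j).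
Proof.
move=> d0 Ah; pose m := (n * n * 2)%N.
have m0 : 0 < m.+1%:R :> C by rewrite ltr0n.
(* an error d' in each entry changes the form by at most m d' times the
   squared norm *)
have d'0 : 0 < d / m.+1%:R by rewrite divr_gt0.
have [N [B0 B0d]] := dense_mx A d'0.
have [B [K [Bh Kh BE]]] := cartesian_fam (fun i j => B0 i j).
exists N, (\matrix_(i, j) B i j).
pose Z i j : L := A i j - lam N (B i j).
have ZE i j : (A - map_mx (lam N) (\matrix_(i, j) B i j)) i j = Z i j by rewrite !mxE.
have qBr := cp_herm (lam_ucp N) Bh; have qKr := cp_herm (lam_ucp N) Kh.
have qZ x : qform Z x = qform (fun i j => A i j) x - qform (fun i j => lam N (B i j)) x.
  rewrite -mulN1r -qformZ -qformD; apply: eq_bigr => i _; apply: eq_bigr => j _.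
  by rewrite scaleN1r.
have Zr x : qform Z x \is Num.real by rewrite qZ rpredB // herm_qform_real.
have Zd x : `|qform Z x| <= d * nrm2 x.
  have -> : qform Z x = 'Re (qform (fun i j => A i j - lam N (B0 i j)) x).
    have -> : qform (fun i j => A i j - lam N (B0 i j)) x
        = qform Z x + 'i * (- qform (fun i j => lam N (K i j)) x).
      rewrite mulrN -mulNr -qformZ -qformD.
      apply: eq_bigr => i _; apply: eq_bigr => j _; congr (sform _ _ _).
      by rewrite BE linearD linearZ /= /Z opprD addrA scaleNr.
    by rewrite Re_rect // rpredN.
  apply: le_trans (leif_le (leif_normC_Re_Creal _)) _.
  apply: le_trans (qform_bound (c := fun _ _ => d / m.+1%:R) x _ _) _.
  - by move=> i j; apply: ltW.
  - by move=> i j v w; apply: sform_small.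
  apply: ler_wpM2r; first exact: nrm2_ge0.
  under eq_bigr => i _ do rewrite sumr_const card_ord.
  rewrite sumr_const card_ord -!mulrnA -/m.
  by rewrite -[leLHS]mulr_natr mulrAC ler_pdivrMr // ler_pM2l // ler_nat.
split.
  have := real_small_pos Zr Zd; move=> h x; have := h x; congr (0 <= _).
  by apply: eq_bigr => i _; apply: eq_bigr => j _; rewrite ZE.
have qNZ x : qform (fun i j => - Z i j) x = - qform Z x.
  rewrite -mulN1r -qformZ; apply: eq_bigr => i _; apply: eq_bigr => j _.
  by rewrite scaleN1r.
have h : pos_fam (fun i j => d *: unit_fam L i j + - Z i j).
  by apply: real_small_pos => x; rewrite qNZ ?rpredN ?normrN.
move=> x; have := h x; congr (0 <= _).
by apply: eq_bigr => i _; apply: eq_bigr => j _; rewrite ZE.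
Qed.

Section Target.
Variable T : opsys C.

Definition unit2 (U : opsys C) n (e : C) : 'M[tens U T]_n :=
  diag_cst n (e *: (mo_unit U ⊗ mo_unit T)).

Lemma unit2D (U : opsys C) n e e' : unit2 U n (e + e') = unit2 U n e + unit2 U n e'.
Proof.
by apply/matrixP => i j; rewrite !mxE; case: eqP; rewrite ?scalerDl ?addr0.
Qed.

Lemma map_unit2 N n e :
  map_mx (tens_mapl (lam N)) (unit2 (S N) n e) = unit2 L n e.
Proof.
apply/matrixP => i j; rewrite !mxE; case: eqP => _; last by rewrite linear0.
by rewrite linearZ /= tens_mapl_pure (lim_unital lim).
Qed.

(** Closeness of [X] to 0 as seen by the cones: the order interval between
    [- e] and [e] for the order of the maximal precones. *)
Definition near_precone n (X : 'M[tens L T]_n) (e : C) :=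
  @max_precones C L T n (X + unit2 L n e) /\ @max_precones C L T n (- X + unit2 L n e).

Lemma near_preconeD n (X Y : 'M[tens L T]_n) e e' :
  near_precone X e -> near_precone Y e' -> near_precone (X + Y) (e + e').
Proof.
move=> [X1 X2] [Y1 Y2]; split; rewrite unit2D ?opprD addrACA;
  exact: max_precones_add.
Qed.

Lemma near_precone_herm_pair n (A : 'M[L]_n) (t : T) (e : C) : 0 < e ->
  herm_pair (A, t) -> exists N (X : 'M[tens (S N) T]_n),
    near_precone (tens_mx A t - map_mx (tens_mapl (lam N)) X) e.
Proof.
move=> e0 [/= Ah th]; have [c c0 tc] := qform_bounded (fun _ _ : 'I_1 => t).
have unit1 (s : T) : (fun _ _ : 'I_1 => c *: mo_unit T + s)
    = (fun i j : 'I_1 => c *: unit_fam T i j + s).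
  by apply/funext => i; apply/funext => j; rewrite /unit_fam !ord1 eqxx.
have tp : pos_fam (fun _ _ : 'I_1 => c *: mo_unit T + t).
  by rewrite unit1; apply: real_small_pos => // x; apply: herm_qform_real.
have qNt x : qform (fun _ _ : 'I_1 => - t) x = - qform (fun _ _ : 'I_1 => t) x.
  rewrite -mulN1r -qformZ; apply: eq_bigr => i _; apply: eq_bigr => j _.
  by rewrite scaleN1r.
have tn : pos_fam (fun _ _ : 'I_1 => c *: mo_unit T - t).
  rewrite unit1; apply: real_small_pos => x; rewrite qNt ?normrN // rpredN.
  exact: herm_qform_real.
(* the error 3 c d of the perturbation lemma is then e *)
have d0 : 0 < e / (c *+ 3) by rewrite divr_gt0 // pmulrn_rgt0.
have [N [B [Zp Zn]]] := dense_herm_mx d0 Ah.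
have dE : e / (c *+ 3) * c *+ 3 = e.
  by rewrite -mulrnAr divfK // gt_eqF // pmulrn_rgt0.
exists N, (tens_mx B t).
have XE : tens_mx A t - map_mx (tens_mapl (lam N)) (tens_mx B t)
    = tens_mx (A - map_mx (lam N) B) t.
  apply/matrixP => i j; rewrite !mxE tens_mapl_pure -scaleN1r -pure_tensZl.
  by rewrite -pure_tensDl scaleN1r.
split; rewrite XE.
  by have := max_precones_small c0 d0 Zp Zn tp tn; rewrite dE.
have XN : - tens_mx (A - map_mx (lam N) B) t = tens_mx (- (A - map_mx (lam N) B)) t.
  by apply/matrixP => i j; rewrite !mxE -scaleN1r -pure_tensZl scaleN1r.
have ZN i j : (- (A - map_mx (lam N) B)) i j = - (A - map_mx (lam N) B) i j.
  by rewrite [LHS]mxE.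
have Zp' : pos_fam (fun i j => e / (c *+ 3) *: unit_fam L i j
    + (- (A - map_mx (lam N) B)) i j).
  by under eq_fun do under eq_fun do rewrite ZN.
have Zn' : pos_fam (fun i j => e / (c *+ 3) *: unit_fam L i j
    - (- (A - map_mx (lam N) B)) i j).
  by under eq_fun do under eq_fun do rewrite ZN opprK.
by have := max_precones_small c0 d0 Zp' Zn' tp tn; rewrite dE XN.
Qed.

(** One term at a time, the tolerance being halved at each step. *)
Lemma near_precone_herm n (X : 'M[tens L T]_n) (e : C) : 0 < e ->
  herm_tensor X -> exists N (X' : 'M[tens (S N) T]_n),
    near_precone (X - map_mx (tens_mapl (lam N)) X') e.
Proof.
move=> + [l [lh ->]]; elim: l lh e => [|[A t] l IHl] lh e e0.
  exists 0, (0 : 'M[tens (S 0) T]_n); rewrite big_nil.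
  have -> : map_mx (tens_mapl (lam 0)) (0 : 'M[tens (S 0) T]_n) = 0.
    by apply/matrixP => i j; rewrite !mxE linear0.
  by split; rewrite ?subrr ?oppr0 add0r; apply/max_precones_unit/ltW.
have e20 : 0 < e / 2 by rewrite divr_gt0.
have [|N1 [X1 h1]] := near_precone_herm_pair (A := A) (t := t) e20.
  by apply: lh; rewrite inE eqxx.
have [|N2 [X2 h2]] := IHl _ _ e20.
  by move=> p pl; apply: lh; rewrite inE pl orbT.
have [X1' E1] := lift_tens X1 (leq_maxl N1 N2).
have [X2' E2] := lift_tens X2 (leq_maxr N1 N2).
exists (maxn N1 N2), (X1' + X2').
have -> : map_mx (tens_mapl (lam (maxn N1 N2))) (X1' + X2')
   = map_mx (tens_mapl (lam N1)) X1 + map_mx (tens_mapl (lam N2)) X2.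
  by rewrite -E1 -E2; apply/matrixP => i j; rewrite !mxE linearD.
rewrite big_cons /= opprD addrACA [e in near_precone _ e]splitr.
exact: near_preconeD.
Qed.

End Target.
End Limit.

(** * Nuclearity of the limit *)
Section Comparison.
Context {C : numClosedFieldType}.

Lemma tens_mapl_id (S T : opsys C) (x : tens S T) :
  tens_mapl (idfun : {linear S -> S}) x = x.
Proof.
rewrite [x]tens_sum; elim: (repr x) => [|p l IHl]; first by rewrite big_nil linear0.
by rewrite big_cons linearD /= IHl tens_mapl_pure.
Qed.

(** The minimal tensor product is the spatial one. *)
Lemma min_conesP (S T : opsys C) n (X : 'M[tens S T]_n) :
  @min_cones C S T n X <-> spatial_pos X.
Proof.
split=> [|Xpos]; first exact: min_spatial_pos.
apply: (spatial_pos_min (lam := (idfun : {linear S -> S}))).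
  by split=> // m Y; rewrite map_mx_id.
by rewrite (_ : map_mx _ X = X) //; apply/matrixP => i j; rewrite mxE tens_mapl_id.
Qed.

Lemma spatial_posD (S T : opsys C) n (X Y : 'M[tens S T]_n) :
  spatial_pos X -> spatial_pos Y -> spatial_pos (X + Y).
Proof.
move=> Xpos Ypos I f v w; have := addr_ge0 (Xpos I f v w) (Ypos I f v w).
congr (0 <= _); rewrite -big_split; apply: eq_bigr => i _ /=.
by rewrite -big_split; apply: eq_bigr => j _ /=; rewrite mxE tformD.
Qed.

(** Generators are spatially positive, and this survives the limit [e -> 0]
    of the Archimedeanization. *)
Lemma max_cones_min (S T : opsys C) n (X : 'M[tens S T]_n) :
  @max_cones C S T n X -> @min_cones C S T n X.
Proof.
move=> Xmax; apply/min_conesP => I f v w.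
have := max_precones_spatial_pos (max_precones_unit n ler01) f v w.
move/ge0_limit; apply=> e e0.
have := max_precones_spatial_pos (Xmax e e0) f v w; congr (0 <= _).
rewrite mulr_sumr -big_split; apply: eq_bigr => i _ /=.
rewrite mulr_sumr -big_split; apply: eq_bigr => j _ /=.
rewrite mxE tformD; congr (_ + _); rewrite -tformZ; congr (tform _ _ _ _ _).
by rewrite !mxE scale1r; case: eqP; rewrite ?scaler0.
Qed.

(** The maximal cones always lie in the minimal ones, so nuclearity is the
    reverse inclusion. *)
Lemma nuclearP (S : opsys C) : nuclear min_cones max_cones S <->
  forall (T : opsys C) n (X : 'M[tens S T]_n),
    @min_cones C S T n X -> @max_cones C S T n X.
Proof.
split=> [Snuc T n X Xmin|SX T].
  by have [_ [_ _ idcp _]] := Snuc T; have := idcp n X Xmin; rewrite map_mx_id.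
exists idfun; split=> // n X; rewrite map_mx_id //.
  exact: SX.
exact: max_cones_min.
Qed.

(** Split [X + e] as [(X - Y + e/3) + (Y + 2 e/3)] with [Y] coming from a
    stage [N]. The first summand is in the precone by approximation. For the
    second, [Y + e/3] is at least [X] in the minimal order, so it is minimal
    positive over the stage [N], and nuclearity of that stage costs another
    [e/3]. *)
Lemma nuclear_inductive_limit (S : nat -> opsys C) (u : forall n, {linear S n -> S n.+1})
    (L : opsys C) (lam : forall n, {linear S n -> L}) :
  (forall n, nuclear min_cones max_cones (S n)) -> inductive_limit u lam ->
  nuclear min_cones max_cones L.
Proof.
move=> Snuc lim; apply/nuclearP => T n X Xmin e e0.
have /min_conesP Xpos := Xmin.
pose k := e / 3; have k0 : 0 < k by rewrite divr_gt0.
have [N [X' [Xnear Xnear']]] := near_precone_herm lim k0 (spatial_pos_herm Xpos).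
set Y := map_mx _ X' in Xnear Xnear'.
have mapD (Z : 'M[tens (S N) T]_n) : map_mx (tens_mapl (lam N)) (Z + unit2 T (S N) n k)
    = map_mx (tens_mapl (lam N)) Z + unit2 T L n k.
  by rewrite map_mxD (map_unit2 lim).
have Ymin : @min_cones C (S N) T n (X' + unit2 T (S N) n k).
  apply: (spatial_pos_min (lim_embedding lim N)); rewrite mapD -/Y.
  have := spatial_posD Xpos (max_precones_spatial_pos Xnear').
  by rewrite opprB addrA addrC [X + _]addrC subrK addrC.
have /nuclearP nucN := Snuc N.
have := max_precones_mapl (lam_ucp lim N).2 (nucN _ _ _ Ymin k k0).
rewrite !mapD -/Y => /(max_precones_add Xnear); congr (max_precones _).
rewrite -/(unit2 T L n e).
have -> : e = k + k + k by rewrite /k; field.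
by rewrite !unit2D -!addrA; congr (_ + _); rewrite addrCA addKr.
Qed.

End Comparison.

Theorem proposition4p2 (R : realType)
  (S : nat -> opsys R[i]) (u : forall n, {linear S n -> S n.+1})
  (L : opsys R[i]) (lam : forall n, {linear S n -> L}) :
  inductive_system u ->
  (forall n, nuclear min_cones max_cones (S n)) ->
  inductive_limit u lam ->
  nuclear min_cones max_cones L.
Proof. by move=> _; apply: nuclear_inductive_limit. Qed.
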